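(* Let $m\ge 1$ and consider random instances of the TSP-$m$TS with $n$ points $X_0,\dots,X_{n-1}$ (including the depot) on the square $\mathcal R=[0,a]^2$, with time horizon $[0,h]$ and time slots $A_1,\dots,A_m$, generated by the TSP-$m$TS random generation model described in the context. In the case of feasibility, the asymptotic length $L_n^{tsp-mts}$ of the shortest tour linking $X_0,\dots,X_{n-1}$ under the Euclidean metric satisfies $$L_{n}^{tsp}\;\le\; L_{n}^{tsp-mts}\;\le\; L_{n}^{tsp-mits},$$ where $L_n^{tsp}$ is the asymptotic length of the shortest tour without time constraints and $L_n^{tsp-mits}$ is the asymptotic length of the shortest tour when the $m$ slots are replaced by $m$ identical slots of length $h/m$.
   Context: **Problem (TSP-$m$TS).** There are $n$ points: a depot $X_0$ and $n-1$ points $X_1,\dots,X_{n-1}$ to visit. The horizon $[0,h]$ is partitioned into $m$ consecutive time slots $A_k=[B_k,F_k]$, $k=1,\dots,m$, with $B_1=0$, $F_m=h$, $F_k=B_{k+1}$ for $1\le k<m$, and lengths $l_k=F_k-B_k>0$. Each point $X_i$, $1\le i\le n-1$, is assigned to one slot. The travel duration and the travel cost between two points both equal their Euclidean distance (unit speed), and service times are zero. A tour starts at the depot at some time in $[0,h]$, visits every other point exactly once, and returns to the depot no later than time $h$. It is feasible if each point can be visited at a time belonging to its assigned slot. A vehicle arriving early may wait, and waiting does not count in the length. The length of a tour is the sum of the Euclidean lengths of its arcs, including the return arc to the depot. The TSP-$m$ITS is the special case $l_k=h/m$ for all $k$. **TSP-$m$TS random generation model.** $X_0,\dots,X_{n-1}$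 are i.i.d. uniform on $\mathcal R=[0,a]^2$, with area $|\mathcal R|=a^2$. The points $X_1,\dots,X_{n-1}$ are assigned to slots at random, i.i.d. and independently of the positions, with probability $p_k=l_k/h$ for slot $A_k$. For convenience, $n$ is restricted to values for which the expected numbers of points $n\,l_k/h$ are integers. The TSP-$m$ITS model is the same with $l_k=h/m$. **Asymptotic length.** The regime is $n\to\infty$ with $m$, $\mathcal R$ and the proportions $l_k/h$ fixed; the horizon $h$ may depend on $n$. The asymptotic length of a problem is the leading-order term $c\sqrt n$ such that, almost surely, the length of the shortest feasible tour equals $c\sqrt n+o(\sqrt n)$. ''In the case of feasibility'' means that, almost surely, feasible tours exist for all sufficiently large $n$ considered, for the problems involved. The inequalities compare these leading-order terms. Their values are $L_n^{tsp}=\beta^{tsp}\sqrt{n|\mathcal R|}$, $\;L_n^{tsp-mts}=\beta^{tsp}\sqrt{n|\mathcal R|/h}\,\sum_{k=1}^m\sqrt{l_k}$, and $L_n^{tsp-mits}=\beta^{tsp}\sqrt{n\,m\,|\mathcal R|}$, where $\beta^{tsp}$ is the Beardwood–Halton–Hammersley constant (for i.i.d. uniform points on a planar square $\mathcal R$, the length of the shortest closed tour through $n$ points divided by $\sqrt n$ converges almost surely to $\beta^{tsp}\sqrt{|\mathcal R|}$). *)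

(* Defs.v *)
From HB Require Import structures.
From mathcomp Require Import all_boot all_order all_algebra.
From mathcomp Require Import all_classical all_reals all_analysis.

Set Implicit Arguments.
Unset Strict Implicit.
Unset Printing Implicit Defensive.

Import Order.TTheory GRing.Theory Num.Theory.
Import numFieldNormedType.Exports.

Local Open Scope classical_set_scope.
Local Open Scope ring_scope.

(* [`|x - y|] on [R * R] is the sup norm, hence an explicit Euclidean
   distance. *)
Definition dist (R : realType) (x y : R * R) : R :=
  Num.sqrt ((x.1 - y.1) ^+ 2 + (x.2 - y.2) ^+ 2).

(* The instance with [n] points (for [n >= 1]) uses the points
   [X 0, ..., X n.-1], with [X 0] the depot.  A tour is given by the order
   [t] in which [1, ..., n.-1] are visited: it runs through the points
   indexed by [0 :: t] and then returns to the point [0]. *)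

Definition is_tour (n : nat) (t : seq nat) : bool := perm_eq t (iota 1 n.-1).

Definition tour_length (R : realType) (X : nat -> R * R) (t : seq nat) : R :=
  \sum_(0 <= j < (size t).+1)
    dist (X (nth 0%N (0%N :: t) j)) (X (nth 0%N (rcons t 0%N) j)).

(* The slot of index [k : 'I_m] (counted from 0) is [`[B k, F k]]. *)
Definition is_slot_partition (R : realType) (m : nat) (h : R)
    (B F : 'I_m -> R) : Prop :=
  [/\ forall k : 'I_m, val k = 0%N -> B k = 0,
      forall k : 'I_m, (val k).+1 = m -> F k = h,
      forall k k' : 'I_m, val k' = (val k).+1 -> F k = B k' &
      forall k : 'I_m, B k < F k].

Definition ident_B (R : realType) (m : nat) (h : R) (k : 'I_m) : R :=
  k%:R * (h / m%:R).

Definition ident_F (R : realType) (m : nat) (h : R) (k : 'I_m) : R :=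
  k.+1%:R * (h / m%:R).

(* [v 0] is the time at which the vehicle leaves the depot and [v j.+1] the
   time of the visit to the [j]-th point of [t].  Waiting is what makes the
   travel constraint an inequality.  The value of [K] at 0 (the depot) is
   irrelevant. *)
Definition is_feasible (R : realType) (m : nat) (h : R) (B F : 'I_m -> R)
    (X : nat -> R * R) (K : nat -> 'I_m) (t : seq nat) : Prop :=
  exists v : nat -> R,
    [/\ 0 <= v 0%N <= h,
        forall j, (j < size t)%N ->
          v j + dist (X (nth 0%N (0%N :: t) j)) (X (nth 0%N t j)) <= v j.+1,
        forall j, (j < size t)%N ->
          B (K (nth 0%N t j)) <= v j.+1 <= F (K (nth 0%N t j)) &
        v (size t) + dist (X (last 0%N t)) (X 0%N) <= h].

Definition tsp_shortest (R : realType) (X : nat -> R * R) (n : nat) : R :=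
  inf [set tour_length X t | t in [set t | is_tour n t]].

Definition mts_has_feasible (R : realType) (m : nat) (h : R) (B F : 'I_m -> R)
    (X : nat -> R * R) (K : nat -> 'I_m) (n : nat) : Prop :=
  exists2 t, is_tour n t & is_feasible h B F X K t.

(* Meaningful under [mts_has_feasible] only: the [inf] of the empty set is 0.
   Otherwise the infimum is over a finite nonempty set, hence a minimum. *)
Definition mts_shortest (R : realType) (m : nat) (h : R) (B F : 'I_m -> R)
    (X : nat -> R * R) (K : nat -> 'I_m) (n : nat) : R :=
  inf [set tour_length X t |
        t in [set t | is_tour n t /\ is_feasible h B F X K t]].

Definition mutually_independent (R : realType) (d : measure_display)
    (T : measurableType d) (P : probability T R) (I : eqType)
    (E : I -> set (set T)) : Prop :=
  forall (s : seq I) (A : I -> set T), uniq s -> (forall i, E i (A i)) ->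
    P (\bigcap_(i in [set` s]) A i) = (\prod_(i <- s) P (A i))%E.

Definition sigma_point (R : realType) (d : measure_display)
    (T : measurableType d) (Y : T -> R * R) : set (set T) :=
  preimage_set_system setT Y
    (@measurable _ (measurableTypeR R * measurableTypeR R)%type).

(* ['I_m] carries the discrete sigma-algebra. *)
Definition sigma_label (d : measure_display) (T : measurableType d) (m : nat)
    (K : T -> 'I_m) : set (set T) :=
  preimage_set_system setT K setT.

Definition square (R : realType) (a : R) : set (R * R) :=
  `[0, a]%classic `*` `[0, a]%classic.

Definition uniform_point (R : realType) (d : measure_display)
    (T : measurableType d) (P : probability T R) (a : R) (Y : T -> R * R) :
    Prop :=
  sigma_point Y `<=` measurable /\
  forall A : set (measurableTypeR R * measurableTypeR R), measurable A ->
    P (Y @^-1` A) =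
    (((a ^+ 2)^-1)%:E *
      ((@lebesgue_measure R) \x (@lebesgue_measure R)) (A `&` square a))%E.

Definition iid_uniform (R : realType) (d : measure_display)
    (T : measurableType d) (P : probability T R) (a : R)
    (X : nat -> T -> R * R) : Prop :=
  (forall i, uniform_point P a (X i)) /\
  mutually_independent P (fun i => sigma_point (X i)).

(* The infinite sequences [X] and [K] generate the instances of all sizes: the
   one with [n] points uses their first [n] terms.  Only the labels
   [K 1, K 2, ...] are constrained.  Mutual independence of the joint family of
   positions [inl i] and labels [inr i] covers the independence of the
   positions, that of the labels, and that of the labels from the positions. *)
Definition mts_model (R : realType) (d : measure_display)
    (T : measurableType d) (P : probability T R) (a : R) (m : nat)
    (p : 'I_m -> R) (X : nat -> T -> R * R) (K : nat -> T -> 'I_m) : Prop :=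
  [/\ forall i, uniform_point P a (X i),
      forall i, sigma_label (K i.+1) `<=` measurable,
      forall i k, P (K i.+1 @^-1` [set k]) = (p k)%:E &
      mutually_independent P (fun j : nat + nat =>
        match j with
        | inl i => sigma_point (X i)
        | inr i => sigma_label (K i.+1)
        end)].

(* The sizes for which all the expected numbers [n * p k] are integers. *)
Definition considered (R : realType) (m : nat) (p : 'I_m -> R) : set nat :=
  [set n | (0 < n)%N /\ forall k, n%:R * p k \is a Num.nat].

(* [L n] is of the form [c * sqrt n], and almost surely
   [len n = L n + o(sqrt n)] as [n] tends to infinity within [N]. *)
Definition is_asymptotic_length (R : realType) (d : measure_display)
    (T : measurableType d) (P : probability T R) (N : set nat)
    (len : nat -> T -> R) (L : nat -> R) : Prop :=
  (exists c : R, forall n, L n = c * Num.sqrt n%:R) /\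
  {ae P, forall w,
    (len n w - L n) / Num.sqrt n%:R @[n --> within N \oo] --> (0 : R)}.

Definition is_BHH_constant (R : realType) (beta : R) : Prop :=
  forall (d : measure_display) (T : measurableType d) (P : probability T R)
      (a : R) (X : nat -> T -> R * R),
    0 < a -> iid_uniform P a X ->
    {ae P, forall w,
      tsp_shortest (fun i => X i w) n / Num.sqrt n%:R @[n --> \oo]
        --> beta * Num.sqrt (a ^+ 2)}.

Definition L_tsp (R : realType) (beta a : R) (n : nat) : R :=
  beta * Num.sqrt (n%:R * a ^+ 2).

Definition L_mts (R : realType) (beta a : R) (m : nat) (h : R)
    (l : 'I_m -> R) (n : nat) : R :=
  beta * Num.sqrt (n%:R * a ^+ 2 / h) * \sum_(k < m) Num.sqrt (l k).

Definition L_mits (R : realType) (beta a : R) (m : nat) (n : nat) : R :=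
  beta * Num.sqrt (n%:R * m%:R * a ^+ 2).

(* Main.v *)
(* Up to coincident points, a feasible tour visits the points slot by slot, and
   inside each slot its path may be replaced by any shorter one with the same
   endpoints.  Hence the shortest feasible tour has length
   [sum_k (shortest closed tour through the points of slot k) + O(1)], with a
   constant depending on [m] and [a] only.  The points of slot [k], listed in
   order of appearance, are again i.i.d. uniform, and by a Chernoff bound and
   Borel-Cantelli their number is almost surely equivalent to [n * p k].  The
   Beardwood-Halton-Hammersley theorem applied to these subsequences gives the
   leading term [beta * a * sqrt n * sum_k sqrt (p k)], and
   [1 <= sum_k sqrt (p k) <= sqrt m] since [sum_k p k = 1]. *)

Require Import Defs.
From HB Require Import structures.
From mathcomp Require Import all_boot all_order all_algebra.
From mathcomp Require Import all_classical all_reals all_analysis.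
From mathcomp Require Import ring lra.

Import Order.TTheory GRing.Theory Num.Theory.
Import numFieldNormedType.Exports.

Local Open Scope classical_set_scope.
Local Open Scope ring_scope.

Set Implicit Arguments.
Unset Strict Implicit.
Unset Printing Implicit Defensive.

(** * Path lengths *)

Section Paths.
Variable R : realType.
Implicit Types (x y z : R * R) (s t : seq (R * R)).

(** Slots share their end times, so a feasible tour may leave the slot order, but only among visits
    at the same place and time; a stable sort by slot therefore leaves the list of (position, time)
    states unchanged. A replacement path inside a slot must also fit the schedule: it starts when
    the old path did, never waits, and is no longer than the old one, so it ends no later and at the
    same place. The constant is [(2 * D + 1) * m + D], with [D = 2 * a] bounding all distances. On
    the probabilistic side, the points of a slot sit at random indices. For a fixed word of the
    first [N] labels these indices are deterministic and distinct, so independence of labels and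
    positions gives a product that is the same for every word; letting [N] grow yields the joint
    law. The extracted sequence needs a default value on the null event where a slot receives
    finitely many points. *)

Lemma dist_ge0 x y : 0 <= dist x y.
Proof. exact: sqrtr_ge0. Qed.

Lemma distxx x : dist x x = 0.
Proof. by rewrite /dist !subrr expr0n addr0 sqrtr0. Qed.

Lemma dist_eq0 x y : dist x y = 0 -> x = y.
Proof.
move=> /eqP; rewrite /dist sqrtr_eq0 => h.
have h1 := sqr_ge0 (x.1 - y.1); have h2 := sqr_ge0 (x.2 - y.2).
have /eqP : (x.1 - y.1) ^+ 2 = 0 by lra.
have /eqP : (x.2 - y.2) ^+ 2 = 0 by lra.
rewrite !sqrf_eq0 !subr_eq0 => /eqP e2 /eqP e1.
by rewrite [x]surjective_pairing [y]surjective_pairing e1 e2.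
Qed.

(** Expanding reduces the claim to Cauchy-Schwarz, [a * c + b * e <= u * v], which after squaring is
    [0 <= (a * e - b * c) ^+ 2] (Lagrange's identity). *)
Lemma minkowski2 (a b c e u v : R) : 0 <= u -> 0 <= v ->
  u ^+ 2 = a ^+ 2 + b ^+ 2 -> v ^+ 2 = c ^+ 2 + e ^+ 2 ->
  (a + c) ^+ 2 + (b + e) ^+ 2 <= (u + v) ^+ 2.
Proof.
move=> u0 v0 eu ev.
suff : a * c + b * e <= u * v by rewrite (sqrrD u v) eu ev; lra.
have uv0 : 0 <= u * v by exact: mulr_ge0.
apply: le_trans (ler_norm _) _; rewrite -(ger0_norm uv0) -ler_sqr ?nnegrE//.
rewrite !real_normK ?num_real// (exprMn 2 u v) eu ev.
have := sqr_ge0 (a * e - b * c); lra.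
Qed.

Lemma dist_triangle x y z : dist x z <= dist x y + dist y z.
Proof.
rewrite -ler_sqr ?nnegrE ?addr_ge0 ?dist_ge0//.
rewrite {1}/dist sqr_sqrtr ?addr_ge0 ?sqr_ge0//.
rewrite -(subrKA y.1 x.1) -(subrKA y.2 x.2).
by apply: minkowski2; rewrite ?dist_ge0// /dist sqr_sqrtr// addr_ge0 ?sqr_ge0.
Qed.

Fixpoint path_length x s : R :=
  if s is y :: s' then dist x y + path_length y s' else 0.

Definition open_length s : R := if s is x :: s' then path_length x s' else 0.

Definition closed_length s : R :=
  if s is x :: s' then path_length x (rcons s' x) else 0.

Lemma path_length_ge0 x s : 0 <= path_length x s.
Proof. by elim: s x => //= y s ih x; rewrite addr_ge0 ?dist_ge0. Qed.

Lemma path_length_cat x s t :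
  path_length x (s ++ t) = path_length x s + path_length (last x s) t.
Proof. by elim: s x => [|y s ih] x /=; rewrite ?add0r// ih addrA. Qed.

Lemma path_length_rcons x s y :
  path_length x (rcons s y) = path_length x s + dist (last x s) y.
Proof. by rewrite -cats1 path_length_cat /= addr0. Qed.

Lemma open_length_le x s : open_length s <= path_length x s.
Proof. by case: s => //= y s; rewrite lerDr dist_ge0. Qed.

Lemma path_length_remove x s y t :
  path_length x (s ++ t) <= path_length x (s ++ y :: t).
Proof.
rewrite !path_length_cat lerD2l; case: t => [|z t] /=.
  by rewrite addr0 dist_ge0.
by rewrite addrA lerD2r dist_triangle.
Qed.

Lemma closed_length_catC s t : closed_length (s ++ t) = closed_length (t ++ s).
Proof.
case: s t => [|x s] [|y t]; rewrite ?cats0//=.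
rewrite -!cats1 -!catA /= !path_length_cat /= !path_length_cat /= !addr0.
by ring.
Qed.

Lemma closed_length_rot i s : closed_length (rot i s) = closed_length s.
Proof. by rewrite /rot closed_length_catC cat_take_drop. Qed.

(** Only the arcs entering the blocks are dropped. *)
Lemma open_length_flatten (ss : seq (seq (R * R))) x :
  \sum_(s <- ss) open_length s <= path_length x (flatten ss).
Proof.
elim: ss x => [|s ss ih] x /=; first by rewrite big_nil.
by rewrite big_cons path_length_cat lerD// open_length_le.
Qed.

Lemma tour_lengthE (X : nat -> R * R) (t : seq nat) :
  tour_length X t = path_length (X 0%N) (rcons (map X t) (X 0%N)).
Proof.
rewrite /tour_length -map_rcons.
(* Only the starting point is generalised; the other zeros are the summation bound, the defaults of
   [nth] and the final return to the depot. *)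
move: {3 6}(0%N) => x.
elim: t x => [|y t ih] x /=; first by rewrite big_nat1 /= addr0.
by rewrite big_nat_recl//= -ih.
Qed.

Lemma tour_length_closed (X : nat -> R * R) (t : seq nat) :
  tour_length X t = closed_length (map X (0%N :: t)).
Proof. by rewrite tour_lengthE. Qed.

Lemma tour_length_ge0 (X : nat -> R * R) (t : seq nat) : 0 <= tour_length X t.
Proof. by rewrite tour_lengthE path_length_ge0. Qed.

End Paths.

(** * Shortest tours through a subsequence of points *)

Section TspShortest.
Variable R : realType.
Implicit Types (X Y : nat -> R * R) (S b c : seq nat).

Lemma tour_lengths_lbound X (A : set (seq nat)) :
  has_lbound [set tour_length X t | t in A].
Proof. by exists 0 => _ [t _ <-]; exact: tour_length_ge0. Qed.

Lemma tsp_shortest_ge0 Y n : 0 <= tsp_shortest Y n.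
Proof.
apply: lb_le_inf; last by move=> _ [t _ <-]; exact: tour_length_ge0.
by exists (tour_length Y (iota 1 n.-1)); exists (iota 1 n.-1) => //=; exact: perm_refl.
Qed.

(** Closed length is invariant under rotation, so any closed tour may be started at the point of
    index 0, which plays the depot in [tsp_shortest]. *)
Lemma tsp_shortest_le X Y S b :
  (forall j, (j < size S)%N -> Y j = X (nth 0%N S j)) -> perm_eq b S ->
  tsp_shortest Y (size S) <= closed_length (map X b).
Proof.
move=> YE /(perm_iotaP 0%N) [q pq ->].
have -> : map X [seq nth 0%N S i | i <- q] = map Y q.
  rewrite -map_comp; apply/eq_in_map => j /=.
  by rewrite (perm_mem pq) mem_iota add0n => /andP[_ /YE].
(* Without points, the only tour is the empty one, of length [dist (Y 0) (Y 0) = 0]. *)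
case: (posnP (size S)) => [S0|S0].
  move: pq; rewrite S0 /= => /perm_nilP -> /=.
  apply: ge_inf; first exact: tour_lengths_lbound.
  by exists [::] => //; rewrite tour_lengthE /= distxx addr0.
have q0 : 0%N \in q by rewrite (perm_mem pq) mem_iota.
have [i t rt] := rot_to q0.
have pt : perm_eq t (iota 1 (size S).-1).
  rewrite -(perm_cons 0%N) -rt perm_rot (perm_trans pq)//.
  by rewrite -[in iota 0 _](prednK S0) /= perm_refl.
apply: ge_inf; first exact: tour_lengths_lbound.
by exists t => //; rewrite tour_length_closed -rt map_rot closed_length_rot.
Qed.

(** The slack 1 allows the infimum to be used through near-minimisers; it only enters the bounded
    error. *)
Lemma tsp_shortest_adherent X Y S :
  (forall j, (j < size S)%N -> Y j = X (nth 0%N S j)) ->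
  exists2 b, perm_eq b S &
    closed_length (map X b) <= tsp_shortest Y (size S) + 1.
Proof.
move=> YE; case: (posnP (size S)) => [S0|S0].
  exists [::]; first by rewrite (size0nil S0).
  by rewrite /= addr_ge0// tsp_shortest_ge0.
have : has_inf [set tour_length Y t | t in [set t | is_tour (size S) t]].
  split; last exact: tour_lengths_lbound.
  exists (tour_length Y (iota 1 (size S).-1)); exists (iota 1 (size S).-1) => //=.
  exact: perm_refl.
move=> /(inf_adherent ltr01) [_ [t ht <-] hlt].
have pt : perm_eq (0%N :: t) (iota 0 (size S)).
  by rewrite -[in iota 0 _](prednK S0) /= perm_cons.
exists [seq nth 0%N S i | i <- 0%N :: t].
  by apply/(perm_iotaP 0%N); exists (0%N :: t).
have -> : map X [seq nth 0%N S i | i <- 0%N :: t] = map Y (0%N :: t).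
  rewrite -map_comp; apply/eq_in_map => j /=.
  by rewrite (perm_mem pt) mem_iota add0n => /andP[_ /YE].
by rewrite -tour_length_closed ltW.
Qed.

(* Rotate the closed tour so that it starts at the first point of [b], then
   postpone the visit to the last point of [b]. *)
Lemma path_improve X D b c :
  (forall i j, dist (X i) (X j) <= D) -> uniq b -> perm_eq c b ->
  exists b', [/\ perm_eq b' b, head 0%N b' = head 0%N b,
    last 0%N b' = last 0%N b,
    open_length (map X b') <= open_length (map X b) &
    open_length (map X b') <= closed_length (map X c) + D].
Proof.
move=> hD ub pc.
have D0 : 0 <= D := le_trans (dist_ge0 _ _) (hD 0%N 0%N).
(* If [b] meets the bound it is kept; otherwise any path meeting the bound is shorter than [b]. *)
have [le_b|/ltW gt_b] :=
    leP (open_length (map X b)) (closed_length (map X c) + D).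
  by exists b; split.
suff [b' [h1 h2 h3 h4]] : exists b', [/\ perm_eq b' b, head 0%N b' = head 0%N b,
    last 0%N b' = last 0%N b &
    open_length (map X b') <= closed_length (map X c) + D].
  by exists b'; split => //; exact: le_trans gt_b.
have cl0 : 0 <= closed_length (map X c).
  by case: (c) => //= z s; exact: path_length_ge0.
case: b ub pc {gt_b} => [|z b] ub pc.
  by exists [::]; split => //=; rewrite addr_ge0.
case/lastP: b ub pc => [|b e] ub pc.
  by exists [:: z]; split => //=; rewrite addr_ge0.
have zc : z \in c by rewrite (perm_mem pc) mem_head.
have [i c' rc] := rot_to zc.
have pc' : perm_eq c' (rcons b e).
  by rewrite -(perm_cons z) -rc perm_rot.
have ec : e \in c' by rewrite (perm_mem pc') mem_rcons mem_head.
case/splitPr: ec rc pc' => c1 c2 rc pc'.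
exists (z :: rcons (c1 ++ c2) e); split => //=.
- rewrite perm_cons; apply: perm_trans pc'.
  by rewrite perm_rcons -cat1s perm_catCA.
- by rewrite !last_rcons.
(* Deleting [e] from the rotated tour and dropping the return arc lengthens nothing; the new last
   arc, into [e], costs at most [D]. *)
rewrite map_rcons path_length_rcons; apply: lerD.
  rewrite -(closed_length_rot i) -map_rot rc /=.
  rewrite map_cat (le_trans (path_length_remove _ _ (X e) _))//.
  by rewrite -map_cons -map_cat path_length_rcons lerDl dist_ge0.
by rewrite (last_map X _ z).
Qed.

End TspShortest.

(** * Reduction to the slots *)

Section SlotSort.
Variables (R : realType) (m : nat).

(** A stable sort, written as a concatenation of filters so that its blocks are the slots. *)
Definition bucket (A : Type) (lab : A -> 'I_m) (s : seq A) : seq A :=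
  flatten [seq [seq q <- s | lab q == k] | k <- enum 'I_m].

Lemma perm_bucket (A : eqType) (lab : A -> 'I_m) (s : seq A) :
  perm_eq (bucket lab s) s.
Proof.
apply/permP => f; rewrite /bucket count_flatten -map_comp sumnE big_map big_enum /=.
under eq_bigr do rewrite count_filter.
elim: s => [|x s ih] /=; first by rewrite big1.
rewrite big_split /= ih (bigD1 (lab x))//= eqxx andbT big1 ?addn0//.
by move=> k; rewrite eq_sym => /negPf ->; rewrite andbF.
Qed.

Lemma map_bucket (A B : Type) (g : A -> B) (lab : B -> 'I_m) (s : seq A) :
  bucket lab (map g s) = map g (bucket (lab \o g) s).
Proof.
rewrite /bucket map_flatten -map_comp; congr flatten; apply: eq_map => k /=.
by rewrite filter_map.
Qed.

(* The bucket sort only moves an element past elements with the same image. *)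
Lemma map_bucket_id (A B : eqType) (f : A -> B) (lab : A -> 'I_m) (s : seq A) :
  pairwise (fun q q' => (lab q' < lab q)%N ==> (f q == f q')) s ->
  map f (bucket lab s) = map f s.
Proof.
elim: s => [_|x s ih].
  rewrite /bucket; elim: (enum _) => //= k e ->//.
rewrite pairwise_cons => /andP[xs /ih ihs]; rewrite [RHS]/= -ihs {ih ihs}.
have : pairwise (fun k k' : 'I_m => (k < k')%N) (enum 'I_m).
  rewrite -sorted_pairwise; last by move=> i j k; exact: ltn_trans.
  have := iota_ltn_sorted 0 m.
  by rewrite -val_enum_ord sorted_map.
rewrite /bucket; have := mem_enum 'I_m (lab x); rewrite inE.
case/splitPr => e1 e2.
rewrite pairwise_cat pairwise_cons => /and3P[he1 _ /andP[he2 _]].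
rewrite !map_cat !flatten_cat /= eqxx /= !map_cat /=.
have -> : [seq [seq q <- x :: s | lab q == k] | k <- e1] =
          [seq [seq q <- s | lab q == k] | k <- e1].
  apply/eq_in_map => k ke /=.
  have := allrelP he1 k (lab x) ke (mem_head _ _).
  by case: eqP => // ->; rewrite ltnn.
have -> : [seq (if lab x == k then x :: [seq q <- s | lab q == k]
                else [seq q <- s | lab q == k]) | k <- e2] =
          [seq [seq q <- s | lab q == k] | k <- e2].
  apply/eq_in_map => k ke /=.
  by have := allP he2 k ke; case: eqP => // ->; rewrite ltnn.
rewrite -cat1s catA -[RHS]cat1s [in RHS]catA map_cat; congr (_ ++ _).
set b := map f _.
(* The elements sorted before [x] come after it in [s] with a smaller label, hence have the same
   image as [x]; and [f x] commutes with a constant list. *)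
have : all (pred1 (f x)) b.
  apply/allP => y /mapP[q /flatten_mapP[k ke]].
  rewrite mem_filter => /andP[/eqP lq qs] -> /=.
  have := allP xs q qs; rewrite eq_sym => /implyP; apply.
  by rewrite lq; exact: (allrelP he1 k (lab x) ke (mem_head _ _)).
by elim: b => //= y b ihb /andP[/eqP -> /ihb ->].
Qed.

End SlotSort.

(** * Schedules as paths in space-time *)

Section Timed.
Variable R : realType.

(* States are pairs (position, time); the slack in the inequality is waiting. *)
Definition reaches (p q : (R * R) * R) : bool := p.2 + dist p.1 q.1 <= q.2.

(** Triangle inequality. It extends the travel constraint from consecutive visits to any two
    visits. *)
Lemma reaches_trans : transitive reaches.
Proof.
move=> q p s; rewrite /reaches => h1 h2; apply: le_trans h2.
have := dist_triangle p.1 q.1 s.1; lra.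
Qed.

Lemma path_reaches_length p s : path reaches p s ->
  p.2 + path_length p.1 (map fst s) <= (last p s).2.
Proof.
elim: s p => [|q s ih] p /=; first by rewrite addr0.
by move=> /andP[pq /ih]; move: pq; rewrite /reaches; lra.
Qed.

(** An earlier arrival at the same place is absorbed by waiting. *)
Lemma path_reaches_early p q s : q.1 = p.1 -> q.2 <= p.2 ->
  path reaches p s -> path reaches q s.
Proof.
move=> e le; case: s => //= r s /andP[h ->]; rewrite andbT.
by apply: le_trans h; rewrite e lerD2r.
Qed.

Variables (X : nat -> R * R).

Definition state (q : nat * R) : (R * R) * R := (X q.1, q.2).

Fixpoint timed (x : nat) (tau : R) (s : seq nat) : seq (nat * R) :=
  if s is y :: s' then
    let tau' := tau + dist (X x) (X y) in (y, tau') :: timed y tau' s'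
  else [::].

Lemma timed_fst x tau s : map fst (timed x tau s) = s.
Proof. by elim: s x tau => //= y s ih x tau; rewrite ih. Qed.

Lemma timed_path x tau s : path reaches (X x, tau) (map state (timed x tau s)).
Proof. by elim: s x tau => //= y s ih x tau; rewrite ih /reaches /= lexx. Qed.

Lemma timed_last x tau s : last (X x, tau) (map state (timed x tau s)) =
  (X (last x s), tau + path_length (X x) (map X s)).
Proof.
elim: s x tau => [|y s ih] x tau /=; first by rewrite addr0.
by rewrite ih addrA.
Qed.

Lemma path_reaches_bounds p s q : path reaches p s -> q \in s ->
  p.2 <= q.2 <= (last p s).2.
Proof.
move=> h qs; apply/andP; split.
  have := order_path_min reaches_trans h => /allP /(_ q qs).
  by rewrite /reaches; have := dist_ge0 p.1 q.1; lra.
case/splitPr: qs h => s1 s2; rewrite cat_path last_cat /= => /and3P[_ _ h2].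
by have := path_reaches_length h2; have := path_length_ge0 q.1 (map fst s2); lra.
Qed.

(* [b'] starts at the same time as [b] and does not wait, so that the schedule of
   the later blocks is unaffected. *)
Lemma improve_block D T z b c :
  (forall i j, dist (X i) (X j) <= D) -> uniq (map fst (z :: b)) ->
  perm_eq c (map fst (z :: b)) -> closed_length (map X c) <= T ->
  path reaches (state z) (map state b) ->
  exists b', [/\ perm_eq (map fst (z :: b')) (map fst (z :: b)),
    path reaches (state z) (map state b'),
    (last (state z) (map state b')).1 = (last (state z) (map state b)).1,
    (last (state z) (map state b')).2 <= (last (state z) (map state b)).2 &
    path_length (X z.1) [seq X q.1 | q <- b'] <= T + D].
Proof.
move=> hD ub pc hT hb.
have [[|y b'] [pb hh hl hle hlen]] := path_improve hD ub pc.
  by have := perm_size pb.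
move: pb hh hl hle hlen; rewrite /= => pb yz; subst y => hl hle hlen.
exists (timed z.1 z.2 b'); rewrite timed_fst timed_path.
have lastE (s : seq (nat * R)) :
    last (state z) (map state s) = state (last z s) by rewrite last_map.
split => //.
- by rewrite timed_last lastE /= hl last_map.
(* Without waiting, the duration equals the length, at most that of the old path, which is at most
   the time the old path took. *)
- rewrite timed_last /=; apply: le_trans (path_reaches_length hb) => /=.
  rewrite lerD2l (le_trans hle)// -!map_comp.
  by rewrite (@eq_map _ _ _ (X \o fst)).
have -> : [seq X q.1 | q <- timed z.1 z.2 b'] = map X b'.
  by rewrite -[in RHS](timed_fst z.1 z.2 b') -map_comp.
by apply: le_trans hlen _; rewrite lerD2r.
Qed.

(** A replaced block ends where the old one did and no later, so the remaining blocks keep a valid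
    schedule. Its new times lie between the first and last old times of the block, which belong to
    one slot. Each block costs [T b + D] inside and [D] for the arc entering it; the last [D] is the
    arc to [e]. *)
Lemma improve_blocks (I : eqType) (K : nat -> I) (B F : I -> R) D
    (T : seq (nat * R) -> R) (bs : seq (seq (nat * R))) p e :
  (forall i j, dist (X i) (X j) <= D) ->
  (forall b, b \in bs -> [/\ uniq (map fst b),
      {in b &, forall q q', K q.1 = K q'.1},
      {in b, forall q, B (K q.1) <= q.2 <= F (K q.1)} &
      exists2 c, perm_eq c (map fst b) & closed_length (map X c) <= T b]) ->
  path reaches (state p) (rcons (map state (flatten bs)) (state e)) ->
  exists s, [/\ perm_eq (map fst s) (map fst (flatten bs)),
    path reaches (state p) (rcons (map state s) (state e)),
    {in s, forall q, B (K q.1) <= q.2 <= F (K q.1)} &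
    path_length (X p.1) (rcons [seq X q.1 | q <- s] (X e.1)) <=
      \sum_(b <- bs) (T b + D *+ 2) + D].
Proof.
move=> hD; have D0 : 0 <= D := le_trans (dist_ge0 _ _) (hD 0%N 0%N).
elim: bs p => [|b bs ih] p hbs hp.
  by exists [::]; split => //=; rewrite big_nil addr0 add0r hD.
have hbs' b' : b' \in bs -> _ := fun h => hbs b' (mem_behead (s := b :: bs) h).
have := hbs b (mem_head _ _).
case: b hbs hp => [|z b] hbs hp [ub bK bok [c pc hT]].
  have [s [s1 s2 s3 s4]] := ih p hbs' hp.
  exists s; split => //; rewrite big_cons; apply: le_trans s4 _.
  have cl0 : 0 <= T [::].
    by move: pc hT => /perm_nilP ->.
  by rewrite -addrA lerDr addr_ge0// mulrn_wge0.
move: hp; rewrite /= map_cat rcons_cat cat_path => /and3P[pz hb hr].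
have [b' [pb' hb' X' t' l']] := improve_block hD ub pc hT hb.
have lastE (s : seq (nat * R)) :
    last (state z) (map state s) = state (last z s) by rewrite last_map.
have [s [s1 s2 s3 s4]] : exists s, [/\ perm_eq (map fst s) (map fst (flatten bs)),
    path reaches (state (last z b')) (rcons (map state s) (state e)),
    {in s, forall q, B (K q.1) <= q.2 <= F (K q.1)} &
    path_length (X (last z b').1) (rcons [seq X q.1 | q <- s] (X e.1)) <=
      \sum_(b <- bs) (T b + D *+ 2) + D].
  apply: ih => //; rewrite -lastE.
  exact: path_reaches_early X' t' hr.
exists (z :: b' ++ s); split.
- by have := perm_cat pb' s1; rewrite -!map_cat.
- by rewrite /= map_cat rcons_cat cat_path pz hb' lastE.
- move=> q; rewrite -cat_cons mem_cat => /orP[|/s3//] qb'.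
  have /mapP[q0 q0b q0E] : q.1 \in map fst (z :: b).
    by rewrite -(perm_mem pb') map_f.
  rewrite q0E (bK q0 z q0b (mem_head _ _)).
  have /andP[zB _] := bok z (mem_head _ _).
  have /andP[_ lF] := bok (last z b) (mem_last _ _).
  move: lF; rewrite (bK _ z (mem_last _ _) (mem_head _ _)) => lF.
  have /andP[h1 h2] : z.2 <= q.2 <= (last (state z) (map state b')).2.
    move: qb'; rewrite inE => /predU1P[->|qb'].
      rewrite lexx /=; have := path_reaches_length hb'.
      by have := path_length_ge0 (state z).1 (map fst (map state b')); rewrite /=; lra.
    exact: (path_reaches_bounds hb' (map_f state qb')).
  rewrite (le_trans zB h1) (le_trans (le_trans h2 t'))//.
  by rewrite lastE.
rewrite big_cons /= map_cat rcons_cat path_length_cat.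
have -> : last (X z.1) [seq X q.1 | q <- b'] = X (last z b').1.
  by rewrite (last_map (fun q : nat * R => X q.1)).
by move: l' s4 (hD p.1 z.1); rewrite mulr2n; lra.
Qed.

End Timed.

(** * Feasible tours as schedules *)

Section Feasible.
Variables (R : realType) (m : nat) (h : R) (B F : 'I_m -> R).
Variables (X : nat -> R * R) (K : nat -> 'I_m).

Definition in_slot (q : nat * R) : bool := B (K q.1) <= q.2 <= F (K q.1).

(** The return is the end state at the depot at time [h], so the horizon becomes one more [reaches]
    constraint. *)
Definition is_schedule (v0 : R) (s : seq (nat * R)) : Prop :=
  path (@reaches R) (state X (0%N, v0)) (rcons (map (state X) s) (state X (0%N, h)))
  /\ {in s, forall q, in_slot q}.

Lemma schedule_of_times (e : nat * R) (v : nat -> R) x t :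
  (forall j, (j < size t)%N ->
     v j + dist (X (nth 0%N (x :: t) j)) (X (nth 0%N t j)) <= v j.+1) ->
  (forall j, (j < size t)%N ->
     B (K (nth 0%N t j)) <= v j.+1 <= F (K (nth 0%N t j))) ->
  v (size t) + dist (X (last x t)) (X e.1) <= e.2 ->
  exists s, [/\ map fst s = t,
    path (@reaches R) (state X (x, v 0%N)) (rcons (map (state X) s) (state X e)) &
    {in s, forall q, in_slot q}].
Proof.
elim: t x v => [|y t ih] x v hv hs he.
  by exists [::]; split => //=; rewrite andbT.
have [//|//|//|s [s1 s2 s3]] := ih y (v \o succn).
- by move=> j jt; exact: (hv j.+1).
- by move=> j jt; exact: (hs j.+1).
exists ((y, v 1%N) :: s); split.
- by rewrite /= s1.
- by rewrite /= s2 andbT; exact: (hv 0%N).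
- by move=> q; rewrite inE => /predU1P[->|/s3//]; exact: (hs 0%N).
Qed.

Lemma times_of_schedule (e : nat * R) v0 x s :
  path (@reaches R) (state X (x, v0)) (rcons (map (state X) s) (state X e)) ->
  {in s, forall q, in_slot q} ->
  exists v : nat -> R, let t := map fst s in
  [/\ v 0%N = v0,
    forall j, (j < size t)%N ->
     v j + dist (X (nth 0%N (x :: t) j)) (X (nth 0%N t j)) <= v j.+1,
    forall j, (j < size t)%N ->
     B (K (nth 0%N t j)) <= v j.+1 <= F (K (nth 0%N t j)) &
    v (size t) + dist (X (last x t)) (X e.1) <= e.2].
Proof.
elim: s x v0 => [|[y tau] s ih] x v0.
  by move=> /=; rewrite andbT => he _; exists (fun=> v0).
rewrite [path _ _ _]/= => /andP[hy hp] hs.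
have [v [v1 v2 v3 v4]] := ih _ _ hp (fun q qs => hs q (mem_behead (s := _ :: _) qs)).
exists (fun j => if j is j'.+1 then v j' else v0); split => //.
- by case=> [_|j jt]; [rewrite /= v1|exact: v2].
- by case=> [_|j jt]; [rewrite /= v1; exact: (hs _ (mem_head _ _))|exact: v3].
Qed.

(** From right to left, the bound [v 0 <= h] is recovered from the path, which ends at time [h]
    after a nonnegative length. *)
Lemma feasibleP t : is_feasible h B F X K t <->
  exists v0 s, [/\ 0 <= v0, map fst s = t & is_schedule v0 s].
Proof.
split=> [[v [/andP[v0 _] hv hs he]]|[v0 [s [v0_ge0 <- [hp hs]]]]].
  have [s [s1 s2 s3]] := @schedule_of_times (0%N, h) v 0%N t hv hs he.
  by exists (v 0%N), s; split.
have [v [v1 v2 v3 v4]] := times_of_schedule hp hs.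
exists v; split => //.
rewrite v1 v0_ge0 /=.
have := path_reaches_length hp; rewrite last_rcons /=.
by have := path_length_ge0 (X 0%N) (map fst (rcons (map (state X) s) (X 0%N, h))); lra.
Qed.

Hypothesis hslots : is_slot_partition h B F.

(** Induction on the gap between the two indices. *)
Lemma slot_le (k k' : 'I_m) : (k < k')%N -> F k <= B k'.
Proof.
case: hslots => _ _ hFB hBF.
have H d : forall k k' : 'I_m, val k' = (val k + d.+1)%N -> F k <= B k'.
  elim: d => [|d ih] {}k {}k' e; first by rewrite (hFB k k') ?e ?addn1.
  have lt : ((val k).+1 < m)%N.
    by apply: leq_trans (ltn_ord k'); rewrite e addnS !ltnS leq_addr.
  rewrite (hFB k (Ordinal lt))//; apply: le_trans (ltW (hBF _)) _.
  by apply: ih; rewrite e /= addSnnS.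
move=> lt; apply: (H (k' - k).-1).
by rewrite prednK ?subn_gt0// subnKC// ltnW.
Qed.

(** If [q] precedes [q'] but has a later slot, then [q'.2 <= F (K q'.1) <= B (K q.1) <= q.2], while
    [q] reaches [q']; so the times agree and the distance is 0. This is the hypothesis of
    [map_bucket_id]. *)
Lemma schedule_pairwise v0 s : is_schedule v0 s ->
  pairwise (fun q q' => (K q'.1 < K q.1)%N ==> (state X q == state X q')) s.
Proof.
move=> [hp hs].
have : path (@reaches R) (state X (0%N, v0)) (map (state X) s).
  by move: hp; rewrite rcons_path => /andP[].
rewrite (path_pairwise (@reaches_trans R)) pairwise_cons => /andP[_].
rewrite pairwise_map => hpw.
apply: (@sub_in_pairwise _ (mem s) (relpre (state X) (@reaches R))) => //.
move=> q q' qs q's /= r; apply/implyP => lt.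
have := hs q qs; have := hs q' q's; have := slot_le lt; move: r.
rewrite /in_slot /reaches /= => r le /andP[_ l1] /andP[l2 _].
have d0 := dist_ge0 (X q.1) (X q'.1).
have e2 : q.2 = q'.2 by lra.
have /dist_eq0 e1 : dist (X q.1) (X q'.1) = 0 by lra.
by rewrite /state e1 e2.
Qed.

End Feasible.

(** * The shortest feasible tour against the sum over the slots *)

Section Approx.
Variables (R : realType) (m : nat) (h : R) (B F : 'I_m -> R).
Variables (X : nat -> R * R) (K : nat -> 'I_m) (n : nat) (D : R).
Variables (Y : 'I_m -> nat -> R * R).

Definition members (k : 'I_m) : seq nat := [seq i <- iota 1 n.-1 | K i == k].

Hypothesis hslots : is_slot_partition h B F.
Hypothesis hD : forall i j, dist (X i) (X j) <= D.
Hypothesis hY : forall k j, (j < size (members k))%N ->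
  Y k j = X (nth 0%N (members k) j).

Let tsp k := tsp_shortest (Y k) (size (members k)).

Lemma dist_bound_ge0 : 0 <= D.
Proof. exact: le_trans (dist_ge0 _ _) (hD 0%N 0%N). Qed.

Lemma perm_members (A : eqType) (g : A -> nat) (s : seq A) k :
  perm_eq (map g s) (iota 1 n.-1) ->
  perm_eq (map g [seq q <- s | K (g q) == k]) (members k).
Proof.
move=> ps; have := perm_filter (fun i => K i == k) ps.
by rewrite filter_map.
Qed.

(** Sorting by slot does not change the list of positions, so the tour contains one open path per
    slot; closing each costs at most [D]. *)
Lemma sum_tsp_le_tour t : is_tour n t -> is_feasible h B F X K t ->
  \sum_k tsp k <= tour_length X t + D *+ m.
Proof.
move=> tt /feasibleP[v0 [s [_ st hs]]].
have pw := schedule_pairwise hslots hs.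
have mb : map X (bucket K t) = map X t.
  rewrite -st map_bucket -!map_comp.
  have := map_bucket_id pw => /(congr1 (map fst)); rewrite -!map_comp.
  by move=> e; exact: e.
rewrite tour_lengthE -mb.
apply: (@le_trans _ _ (\sum_(k < m) (open_length (map X [seq i <- t | K i == k]) + D))).
  apply: ler_sum => k _.
  have pk : perm_eq [seq i <- t | K i == k] (members k).
    by rewrite -[X in perm_eq X _]map_id; apply: perm_members; rewrite map_id.
  apply: le_trans (tsp_shortest_le (hY (k := k)) pk) _.
  case: [seq _ <- _ | _] => [|i u] /=; first by rewrite add0r dist_bound_ge0.
  by rewrite path_length_rcons lerD2l last_map.
rewrite big_split /= sumr_const card_ord lerD2r.
rewrite path_length_rcons; apply: ler_wpDr; first exact: dist_ge0.
rewrite /bucket map_flatten -map_comp.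
by apply: le_trans (open_length_flatten _ _); rewrite big_map big_enum.
Qed.

Lemma feasible_tour_le_sum_tsp t : is_tour n t -> is_feasible h B F X K t ->
  exists t', [/\ is_tour n t', is_feasible h B F X K t' &
    tour_length X t' <= \sum_k tsp k + (D *+ 2 + 1) *+ m + D].
Proof.
move=> tt /feasibleP[v0 [s [v0_ge0 st hs]]].
have pw := schedule_pairwise hslots hs.
have [hp hok] := hs.
have mb := map_bucket_id pw.
pose bl k := [seq q <- s | K q.1 == k].
(* The bound must be a function of the block alone, so the slot is read off its first visit; the 1
   is the slack of [tsp_shortest_adherent]. *)
pose T (b : seq (nat * R)) :=
  if b is q :: _ then tsp (K q.1) + 1 else 0.
have pbl k : perm_eq (map fst (bl k)) (members k).
  by apply: perm_members; rewrite st.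
have us : uniq (map fst s) by rewrite st (perm_uniq tt) iota_uniq.
have Tbl k : T (bl k) <= tsp k + 1.
  rewrite /T; case E : (bl k) => [|q b]; first by rewrite addr_ge0 ?tsp_shortest_ge0.
  have : q \in bl k by rewrite E mem_head.
  by rewrite mem_filter => /andP[/eqP ->].
have [||s' [s1 s2 s3 s4]] := @improve_blocks R X _ K B F D T (map bl (enum 'I_m))
    (0%N, v0) (0%N, h) hD.
- move=> b /mapP[k _ ->]; split.
  + by rewrite (perm_uniq (pbl k)) filter_uniq// iota_uniq.
  + by move=> q q'; rewrite !mem_filter => /andP[/eqP -> _] /andP[/eqP -> _].
  + by move=> q; rewrite mem_filter => /andP[_ /hok].
  + have [c pc hc] := tsp_shortest_adherent (hY (k := k)).
    have pcb : perm_eq c (map fst (bl k)) by rewrite (perm_trans pc)// perm_sym.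
    exists c => //; rewrite /T; case E : (bl k) => [|q u].
      by move: pcb; rewrite E => /perm_nilP ->.
    have : q \in bl k by rewrite E mem_head.
    by rewrite mem_filter => /andP[/eqP -> _].
- by rewrite -[flatten _]/(bucket (K \o fst) s) mb.
exists (map fst s'); split.
- apply: perm_trans s1 _; apply: perm_trans tt; rewrite -st.
  exact/perm_map/perm_bucket.
- by apply/feasibleP; exists v0, s'; split.
rewrite tour_lengthE -map_comp; apply: le_trans s4 _; rewrite lerD2r.
have -> : (D *+ 2 + 1) *+ m = \sum_(k < m) (D *+ 2 + 1).
  by rewrite sumr_const card_ord.
rewrite big_map big_enum /= -big_split /=.
apply: ler_sum => k _; have := Tbl k; lra.
Qed.

Lemma mts_shortest_approx : mts_has_feasible h B F X K n ->
  `|mts_shortest h B F X K n - \sum_k tsp k| <= (D *+ 2 + 1) *+ m + D.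
Proof.
move=> [t tt ft].
have D0 := dist_bound_ge0.
have Dm : D *+ m <= (D *+ 2 + 1) *+ m by rewrite lerMn2r; apply/orP; right; lra.
rewrite ler_norml; apply/andP; split.
  rewrite lerBrDr.
  have : \sum_k tsp k - D *+ m <= mts_shortest h B F X K n; last by lra.
  apply: lb_le_inf; first by exists (tour_length X t); exists t.
  by move=> _ [t' [tt' ft'] <-]; rewrite lerBlDr; exact: sum_tsp_le_tour.
have [t' [tt' ft' le]] := feasible_tour_le_sum_tsp tt ft.
rewrite lerBlDl addrA; apply: le_trans le.
by apply: ge_inf; [exact: tour_lengths_lbound|exists t'].
Qed.

End Approx.

(** * Frequencies of the labels *)

Section Chernoff.
Variable R : realType.

(** From [1 - y <= expR (- y)] one gets [expR y * (1 - y) <= 1], and the right-hand side times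
    [1 - y] is [1 + y ^+ 2 * (1 - 2 * y)], at least 1. *)
Lemma expR_le_quadratic (y : R) : `|y| <= 2^-1 -> expR y <= 1 + y + y ^+ 2 *+ 2.
Proof.
rewrite ler_norml => /andP[y1 y2].
have h := expR_ge1Dx (- y).
have e0 := expR_gt0 y.
have e1 : expR y * expR (- y) = 1 by rewrite expRN divff// gt_eqF.
have y3 : 0 <= y ^+ 2 * (1 - y *+ 2) by rewrite mulr_ge0 ?sqr_ge0//; lra.
have h1 : expR y * (1 - y) <= 1 by rewrite -[leRHS]e1 ler_pM2l.
have y4 : 0 < 1 - y by lra.
rewrite -(ler_pM2r y4); apply: le_trans h1 _.
by rewrite [leRHS](_ : _ = 1 + y ^+ 2 * (1 - y *+ 2)) ?lerDl//; ring.
Qed.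

(* The moment generating function of a centred variable bounded by 1, at
   [eps / 4]. *)
Lemma centred_mgf_lt1 (m : nat) (p x : 'I_m -> R) (eps : R) :
  (forall k, 0 <= p k) -> \sum_k p k = 1 -> (forall k, `|x k| <= 1) ->
  \sum_k p k * x k = 0 -> 0 < eps <= 1 ->
  \sum_k p k * expR (eps / 4 * (x k - eps)) < 1.
Proof.
move=> p0 p1 x1 px /andP[e0 e1].
set lam := eps / 4.
have l0 : 0 < lam by rewrite /lam; lra.
have l1 : lam <= 4^-1 by rewrite /lam; lra.
have le1 : expR (lam * - eps) * (1 + lam * eps) <= 1.
  have := expR_ge1Dx (lam * eps).
  have := expR_gt0 (lam * - eps); rewrite mulrN expRN => h1 h2.
  rewrite -[leRHS](mulVf (lt0r_neq0 (expR_gt0 (lam * eps)))).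
  by rewrite ler_pM2l.
(* The quadratic bound with [x k ^+ 2 <= 1]; the term linear in [x] vanishes in the sum because [x]
   is centred. *)
have hk k : p k * expR (lam * (x k - eps)) <=
    (p k + p k * x k * lam + p k * (lam ^+ 2 *+ 2)) * expR (lam * - eps).
  rewrite mulrBr expRD -mulrN mulrA ler_wpM2r ?expR_ge0//.
  have xx : `|x k| <= 1 by exact: x1.
  have : x k ^+ 2 <= 1 by rewrite -real_normK ?num_real// expr_le1.
  have : expR (lam * x k) <= 1 + lam * x k + (lam * x k) ^+ 2 *+ 2.
    by apply: expR_le_quadratic; rewrite normrM (gtr0_norm l0); nra.
  rewrite exprMn => h1 h2.
  have l2 := sqr_ge0 lam.
  have : expR (lam * x k) <= 1 + lam * x k + lam ^+ 2 *+ 2.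
    by apply: le_trans h1 _; rewrite lerD2l lerMn2r ler_piMr.
  move=> /(ler_wpM2l (p0 k)); lra.
apply: le_lt_trans (ler_sum _ (fun k _ => hk k)) _.
rewrite -big_distrl /= !big_split /= -!big_distrl /= p1 px mul0r addr0 mul1r.
have E0 := expR_gt0 (lam * - eps).
apply: lt_le_trans le1; rewrite [ltRHS]mulrC ltr_pM2r//.
(* The choice [lam = eps / 4] puts the second-order term [2 * lam ^+ 2] below
   [lam * eps = 4 * lam ^+ 2]. *)
have eE : eps = lam * 4 by rewrite /lam; lra.
rewrite ltrD2l [in ltRHS]eE; have := mulr_gt0 l0 l0; lra.
Qed.

(** Exponential Markov inequality: on the event, the factor
    [expR (lam * (\sum_i x (c i) - N * eps))] is at least 1, and its weighted sum over all words
    factors into an [N]-th power. *)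
Lemma chernoff_sum (m N : nat) (p x : 'I_m -> R) (eps lam : R) :
  (forall k, 0 <= p k) -> 0 <= lam ->
  \sum_(c : {ffun 'I_N -> 'I_m} | N%:R * eps <= \sum_i x (c i)) \prod_i p (c i)
    <= (\sum_k p k * expR (lam * (x k - eps))) ^+ N.
Proof.
move=> p0 l0.
rewrite -[in leRHS](card_ord N) -prodr_const bigA_distr_bigA /=.
rewrite [leRHS](bigID (fun c : {ffun 'I_N -> 'I_m} =>
  N%:R * eps <= \sum_i x (c i))) /=.
rewrite -[leLHS]addr0; apply: lerD; last first.
  by apply: sumr_ge0 => c _; apply: prodr_ge0 => i _; rewrite mulr_ge0 ?expR_ge0.
apply: ler_sum => c hc; rewrite big_split /= -expR_sum.
rewrite ler_peMr ?prodr_ge0// -expR0 ler_expR -big_distrr /=.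
rewrite mulr_ge0// big_split /= sumr_const card_ord mulNrn subr_ge0.
by rewrite -mulr_natl.
Qed.

End Chernoff.

(** * Joint law of the labels and the positions *)

Section Model.
Variables (R : realType) (d : measure_display) (T : measurableType d).
Variables (P : probability T R) (a : R) (m : nat) (p : 'I_m -> R).
Variables (X : nat -> T -> R * R) (K : nat -> T -> 'I_m).
Hypothesis model : mts_model P a p X K.

Notation plane := (measurableTypeR R * measurableTypeR R)%type.

Lemma measurable_point i (A : set plane) :
  measurable A -> measurable (X i @^-1` A).
Proof.
move=> mA; case: model => /(_ i) [h _] _ _ _; apply: h.
by exists A => //; rewrite setTI.
Qed.

Lemma measurable_label i (C : set 'I_m) : measurable (K i.+1 @^-1` C).
Proof.
by case: model => _ /(_ i) h _ _; apply: h; exists C => //; rewrite setTI.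
Qed.

Lemma point_law i (A : set plane) : measurable A ->
  P (X i @^-1` A) = P (X 0%N @^-1` A).
Proof.
by case: model => hu _ _ _ mA; rewrite (hu i).2// (hu 0%N).2.
Qed.

Lemma label_prob i k : P (K i.+1 @^-1` [set k]) = (p k)%:E.
Proof. by case: model. Qed.

Lemma label_prob_ge0 k : 0 <= p k.
Proof. by rewrite -lee_fin -(label_prob 0). Qed.

(** Entry [i] is the label of point [i.+1], the depot having none. There are finitely many words, so
    conditioning on them is a finite sum. *)
Definition labels (N : nat) (w : T) : {ffun 'I_N -> 'I_m} :=
  [ffun i : 'I_N => K (val i).+1 w].

Lemma labels_preimage N (c : {ffun 'I_N -> 'I_m}) :
  labels N @^-1` [set c] = \bigcap_(i in [set: 'I_N]) (K (val i).+1 @^-1` [set c i]).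
Proof.
apply/seteqP; split => w /=.
  by move=> <- i _ /=; rewrite ffunE.
by move=> h; apply/ffunP => i; rewrite ffunE h.
Qed.

Lemma measurable_labels N (c : {ffun 'I_N -> 'I_m}) :
  measurable (labels N @^-1` [set c]).
Proof.
rewrite labels_preimage; apply: fin_bigcap_measurable => [|i _].
  exact: finite_finset.
exact: measurable_label.
Qed.

Lemma joint_law N (c : {ffun 'I_N -> 'I_m}) (s : seq nat) (A : nat -> set plane) :
  uniq s -> (forall i, measurable (A i)) ->
  P (labels N @^-1` [set c] `&` \bigcap_(i in [set` s]) (X i @^-1` A i)) =
  ((\prod_(i < N) (p (c i))%:E) * \prod_(i <- s) P (X i @^-1` A i))%E.
Proof.
move=> us mA; case: model => _ _ _ ind.
(* Independence asks for an event at every index; labels beyond the first [N] get [setT]. *)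
pose E (j : nat + nat) := match j with
  | inl i => X i @^-1` A i
  | inr i => if insub i is Some i' then K i.+1 @^-1` [set c i'] else setT
  end.
have := ind (map inr (iota 0 N) ++ map inl s) E; rewrite big_cat /= !big_map.
have -> : (\prod_(j <- iota 0 N) P (E (inr j)) = \prod_(i < N) (p (c i))%:E)%E.
  rewrite -[N in iota 0 N]subn0 -/(index_iota 0 N) big_mkord.
  apply: eq_bigr => i _; rewrite /E insubT//= => lt; rewrite label_prob.
  by congr (p (c _))%:E; apply: val_inj.
move=> <-.
- congr (P _); apply/seteqP; split => w /=.
    move=> [cw hw] [i|i] /=; rewrite mem_cat.
      case/orP => [/mapP[]//|]; rewrite mem_map; last by move=> ? ? [].
      exact: hw.
    by move=> _; case: insubP => //= i' _ <-; rewrite -cw ffunE.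
  move=> hw; split.
    apply/ffunP => i; rewrite ffunE.
    have := hw (inr (val i)); rewrite /= insubT//= => lt.
    move=> ->; first by congr (c _); apply: val_inj.
    by rewrite mem_cat mem_map ?mem_iota ?lt// => ? ? [].
  move=> i /= si; have := hw (inl i); apply.
  by rewrite /= mem_cat [X in _ || X]mem_map ?si ?orbT// => ? ? [].
- rewrite cat_uniq !map_inj_uniq ?iota_uniq ?us//; [|by move=> ? ? []|by move=> ? ? []].
  by rewrite andbT; apply/hasPn => _ /mapP[i _ ->]; apply/negP => /mapP[].
- case=> i /=; first by exists (A i) => //; rewrite setTI.
  case: insubP => [i' _ _|_].
    by exists [set c i'] => //; rewrite setTI.
  by exists setT => //; rewrite setTI preimage_setT.
Qed.

Lemma labels_split N (E : {ffun 'I_N -> 'I_m} -> set T) :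
  [set w | E (labels N w) w] =
  \bigcup_(c in [set` enum {ffun 'I_N -> 'I_m}]) (labels N @^-1` [set c] `&` E c).
Proof.
apply/seteqP; split => w /=.
  by move=> h; exists (labels N w) => //=; rewrite mem_enum.
by move=> [c _ [/= <-]].
Qed.

Lemma measurable_labels_dep N (E : {ffun 'I_N -> 'I_m} -> set T) :
  (forall c, measurable (E c)) -> measurable [set w | E (labels N w) w].
Proof.
move=> mE; rewrite labels_split; apply: fin_bigcup_measurable => // c _.
by apply: measurableI => //; exact: measurable_labels.
Qed.

Lemma prob_labels_dep N (E : {ffun 'I_N -> 'I_m} -> set T) :
  (forall c, measurable (E c)) ->
  P [set w | E (labels N w) w] =
  (\sum_(c : {ffun 'I_N -> 'I_m}) P (labels N @^-1` [set c] `&` E c))%E.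
Proof.
move=> mE; rewrite labels_split measure_fin_bigcup//.
- by rewrite -fsbig_seq ?enum_uniq// big_enum.
- by move=> c c' _ _ [w [[/= <- _] [/= <- _]]].
- by move=> c _; apply: measurableI => //; exact: measurable_labels.
Qed.

Lemma prob_labels N (Q : pred {ffun 'I_N -> 'I_m}) :
  P [set w | Q (labels N w)] = (\sum_(c | Q c) \prod_(i < N) p (c i))%:E.
Proof.
have -> : [set w | Q (labels N w)] =
    [set w | (fun c => [set _ : T | Q c]) (labels N w) w] by [].
have mQ c : measurable [set _ : T | Q c].
  by case: (Q c); [rewrite (_ : mkset _ = setT)|rewrite (_ : mkset _ = set0)];
    rewrite -?subTset//; apply/seteqP; split.
rewrite (@prob_labels_dep N (fun c => [set _ : T | Q c]))//.
rewrite -sumEFin [RHS]big_mkcond; apply: eq_bigr => c _.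
case: ifPn => Qc.
  rewrite (_ : [set _ | _] = setT) ?setIT; last by apply/seteqP; split.
  have := @joint_law N c [::] (fun=> setT) isT (fun=> measurableT).
  by rewrite big_nil mule1 -prodEFin set_nil bigcap_set0 setIT.
by rewrite (_ : [set _ | _] = set0) ?setI0 ?measure0//; apply/seteqP; split.
Qed.

(** Total mass of the label words of length 1. *)
Lemma sum_label_prob : \sum_k p k = 1.
Proof.
have := @prob_labels 1 predT.
rewrite (_ : [set w | _] = setT); last by apply/seteqP; split.
rewrite probability_setT => -[->].
rewrite (eq_bigr (fun c : {ffun 'I_1 -> 'I_m} => \prod_(i < 1) p (c i)))//.
by rewrite -(bigA_distr_bigA (fun (i : 'I_1) k => p k)) big_ord1.
Qed.

End Model.

Lemma size_members (m : nat) (K : nat -> 'I_m) (N : nat) (k : 'I_m) :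
  size (members K N.+1 k) = (\sum_(i < N) (K i.+1 == k))%N.
Proof.
rewrite size_filter -sum1_count big_mkcond /= (iotaDl 1 0) big_map.
rewrite -[N in iota 0 N]subn0 -/(index_iota 0 N) big_mkord.
by apply: eq_bigr => i _; case: eqP.
Qed.

(** * Almost sure frequencies *)

Section LawOfLargeNumbers.
Variables (R : realType) (d : measure_display) (T : measurableType d).
Variables (P : probability T R) (a : R) (m : nat) (p : 'I_m -> R).
Variables (X : nat -> T -> R * R) (K : nat -> T -> 'I_m).
Hypothesis model : mts_model P a p X K.

(** The bad event at [N] has probability at most [q ^+ N], where [q < 1] is the shifted moment
    generating function at [eps / 4]; this is summable. *)
Lemma labels_upper_tail (x : 'I_m -> R) (eps : R) :
  (forall k, `|x k| <= 1) -> \sum_k p k * x k = 0 -> 0 < eps <= 1 ->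
  {ae P, forall w, \forall N \near \oo,
    \sum_(i < N) x (K i.+1 w) < N%:R * eps}.
Proof.
move=> x1 px heps; have /andP[e0 e1] := heps.
have p0 := label_prob_ge0 model; have p1 := sum_label_prob model.
have := centred_mgf_lt1 p0 p1 x1 px heps.
set q := \sum_k _ => q1.
have q0 : 0 <= q by apply: sumr_ge0 => k _; rewrite mulr_ge0 ?expR_ge0.
pose bad N := [set w | N%:R * eps <= \sum_(i < N) x (labels K N w i)].
have mbad N : measurable (bad N).
  have := @measurable_labels_dep _ _ _ _ _ _ _ _ _ model N
    (fun c => if N%:R * eps <= \sum_(i < N) x (c i) then setT else set0).
  rewrite (_ : [set w | _] = bad N).
    by apply => c; case: ifP.
  by apply/seteqP; split => w /=; rewrite /bad /=; case: ifP.
exists (lim_sup_set bad); split.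
- apply: bigcapT_measurable => n; exact: bigcup_measurable.
- apply: lim_sup_set_cvg0 => //.
  apply: (@le_lt_trans _ _ (\sum_(0 <= N <oo) (q ^+ N)%:E)%E); last first.
    apply: (@le_lt_trans _ _ ((1 - q)^-1)%:E); last exact: ltry.
    apply: lime_le.
      by apply: is_cvg_nneseries => n _ _; rewrite lee_fin exprn_ge0.
    apply: nearW => n; rewrite sumEFin lee_fin.
    have q1' : 0 < 1 - q by rewrite subr_gt0.
    rewrite -(ler_pM2l q1') divff ?gt_eqF// -opprB mulNr big_mkord -subrX1 opprB.
    by rewrite gerBl exprn_ge0.
  apply: lee_nneseries => [N _ _|N _]; first exact: measure_ge0.
  rewrite -[leLHS]/(P (bad N)).
  have -> : P (bad N) = _ := prob_labels model
    (fun c : {ffun 'I_N -> 'I_m} => N%:R * eps <= \sum_(i < N) x (c i)).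
  by rewrite lee_fin; apply: chernoff_sum => //; rewrite divr_ge0// ltW.
move=> w /= hw N _ /=.
apply: contrapT => hN; apply: hw.
exists N => // n /= Nn; rewrite ltNge; apply/negP => hb; apply: hN.
exists n => //; rewrite /bad /=.
by rewrite (eq_bigr (fun i : 'I_n => x (K i.+1 w)))// => i _; rewrite ffunE.
Qed.

Lemma label_frequency k :
  {ae P, forall w, (size (members (fun i => K i w) n k))%:R / n%:R
    @[n --> \oo] --> p k}.
Proof.
have p0 := label_prob_ge0 model; have p1 := sum_label_prob model.
have pk1 : p k <= 1 by rewrite -p1 (bigD1 k)//= lerDl sumr_ge0.
pose x (j : 'I_m) : R := (j == k)%:R - p k.
have x1 j : `|x j| <= 1.
  by rewrite /x ler_norml; have := p0 k; case: eqP => _ /=; lra.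
have px : \sum_j p j * x j = 0.
  under eq_bigr do rewrite mulrBr.
  rewrite sumrB -big_distrl /= p1 mul1r (bigD1 k)//= eqxx mulr1 big1 ?addr0 ?subrr//.
  by move=> j /negPf ->; rewrite mulr0.
(* The sign [s] gives both one-sided bounds; the tolerances [1 / l.+1] keep the number of null sets
   countable. *)
have dev (s : R) : `|s| <= 1 -> {ae P, forall w, forall l : nat, \forall N \near \oo,
    \sum_(i < N) s * x (K i.+1 w) < N%:R * l.+1%:R^-1}.
  move=> s1; apply: ae_foralln => l.
  apply: (labels_upper_tail (x := fun j => s * x j)).
  - by move=> j; rewrite normrM mulr_ile1.
  - under eq_bigr do rewrite mulrCA.
    by rewrite -big_distrr /= px mulr0.
  - by rewrite invr_gt0 ltr0n /= invf_le1 ?ler1n ?ltr0n.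
have dp := dev 1; have dn := dev (-1); rewrite normrN1 in dn.
have := dp _; rewrite normr1 => /(_ (lexx _)) => {}dp; move: (dn (lexx _)) => {}dn.
apply: filterS2 dp dn => w hp hn.
have fr : (size (members (fun i => K i w) n.+1 k))%:R / n%:R @[n --> \oo] --> p k.
  apply/cvgrPdist_lt => e e0.
  have [l le] : exists l : nat, l.+1%:R^-1 < e.
    exists (Num.truncn e^-1); rewrite invf_plt ?posrE ?ltr0n//.
    by rewrite truncnS_gt.
  near=> n.
  have n0 : (0 < n)%N by near: n; exact: nbhs_infty_gt.
  have n0R : 0 < n%:R :> R by rewrite ltr0n.
  apply: lt_trans le.
  have h1 : \sum_(i < n) 1 * x (K i.+1 w) < n%:R * l.+1%:R^-1.
    by near: n; exact: hp.
  have h2 : \sum_(i < n) -1 * x (K i.+1 w) < n%:R * l.+1%:R^-1.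
    by near: n; exact: hn.
  have sx : \sum_(i < n) x (K i.+1 w) =
      (size (members (fun i => K i w) n.+1 k))%:R - n%:R * p k.
    rewrite size_members natr_sum /x sumrB; congr (_ - _).
    by rewrite sumr_const card_ord mulr_natl.
  have -> : p k - (size (members (fun i => K i w) n.+1 k))%:R / n%:R =
      - (\sum_(i < n) x (K i.+1 w)) / n%:R.
    by rewrite sx; field; rewrite gt_eqF.
  rewrite normrM normrN [X in _ * X]gtr0_norm ?invr_gt0// ltr_pdivrMr// mulrC.
  move: h1 h2; rewrite -!big_distrr /= mul1r mulN1r => h1 h2.
  by rewrite ltr_norml h1 ltrNl h2.
(* An instance with [n.+1] points has [n] labels; the factor [1 - harmonic n = n / n.+1] corrects
   the denominator. *)
suff fr1 : (size (members (fun i => K i w) n.+1 k))%:R / n.+1%:R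
    @[n --> \oo] --> p k by rewrite -cvg_shiftS.
have h1 : 1 - harmonic n @[n --> \oo] --> (1 : R).
  have := cvgB (cvg_cst (1 : R)) (@cvg_harmonic R).
  by rewrite subr0; apply.
have h2 : (size (members (fun i => K i w) n.+1 k))%:R / n%:R * (1 - harmonic n)
    @[n --> \oo] --> p k.
  by have := cvgM fr h1; rewrite mulr1; exact.
apply: (cvg_trans _ h2); apply: near_eq_cvg.
near=> n.
have n0 : (0 < n)%N by near: n; exact: nbhs_infty_gt.
rewrite /harmonic /=; set u := (size _)%:R.
have n0R : 0 < n%:R :> R by rewrite ltr0n.
rewrite -natr1; field.
by rewrite natr1 !pnatr_eq0 /= ?andbT -lt0n.
Unshelve. all: by end_near.
Qed.

End LawOfLargeNumbers.

(** * The points of a given label *)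

Lemma members_prefix (m : nat) (K : nat -> 'I_m) (k : 'I_m) n n' :
  (n <= n')%N -> exists s, members K n' k = members K n k ++ s.
Proof.
move=> le; have := subnKC (leq_sub2r 1 le); rewrite !subn1 /members => <-.
rewrite iotaD filter_cat.
by eexists.
Qed.

Lemma nth_members (m : nat) (K : nat -> 'I_m) (k : 'I_m) n n' j :
  (j < size (members K n k))%N -> (j < size (members K n' k))%N ->
  nth 0%N (members K n k) j = nth 0%N (members K n' k) j.
Proof.
move=> jn jn'; wlog le : n n' jn jn' / (n <= n')%N => [hw|].
  by case/orP: (leq_total n n') => le; [|symmetry]; exact: hw.
by have [s ->] := members_prefix K k le; rewrite nth_cat jn.
Qed.

Lemma leq_size_members (m : nat) (K : nat -> 'I_m) (k : 'I_m) n n' :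
  (n <= n')%N -> (size (members K n k) <= size (members K n' k))%N.
Proof.
by move=> /(members_prefix K k)[s ->]; rewrite size_cat leq_addr.
Qed.

Lemma eq_members (m : nat) (K K' : nat -> 'I_m) (k : 'I_m) n :
  (forall i, (i.+1 < n)%N -> K i.+1 = K' i.+1) -> members K n k = members K' n k.
Proof.
move=> e; apply: eq_in_filter => i; rewrite mem_iota.
by case: i => // i; case: n e => //= n e; rewrite add1n => /e ->.
Qed.

(* The index of the [j]-th point (counted from 0) of label [k]; it is 0 when
   there are at most [j] such points. *)
Definition member_index (m : nat) (K : nat -> 'I_m) (k : 'I_m) (j : nat) : nat :=
  xget 0%N [set i | exists n,
    (j < size (members K n k))%N /\ i = nth 0%N (members K n k) j].

Lemma member_indexE (m : nat) (K : nat -> 'I_m) (k : 'I_m) n j :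
  (j < size (members K n k))%N -> member_index K k j = nth 0%N (members K n k) j.
Proof.
move=> jn; rewrite /member_index; set A := [set i | _].
have /(xgetPex 0%N)[n' [jn' ->]] : exists i, A i by exists (nth 0%N (members K n k) j), n.
exact: nth_members.
Qed.

Lemma member_index_default (m : nat) (K : nat -> 'I_m) (k : 'I_m) j :
  (forall n, (size (members K n k) <= j)%N) -> member_index K k j = 0%N.
Proof.
move=> h; rewrite /member_index xgetPN// => i [n []].
by rewrite ltnNge h.
Qed.

Section Thinning.
Variables (R : realType) (d : measure_display) (T : measurableType d).
Variables (P : probability T R) (a : R) (m : nat) (p : 'I_m -> R).
Variables (X : nat -> T -> R * R) (K : nat -> T -> 'I_m).
Hypothesis model : mts_model P a p X K.
Variable k : 'I_m.
Hypothesis pk_gt0 : 0 < p k.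

Notation plane := (measurableTypeR R * measurableTypeR R)%type.

(** When label [k] occurs at most [j] times, the default index 0 yields the depot, which makes the
    point defined on all of [T]. *)
Definition thin (j : nat) (w : T) : R * R :=
  X (member_index (fun i => K i w) k j) w.

Let mem w N := members (fun i => K i w) N.+1 k.

(** Undoes the shift by one of [labels]. Only points [1] to [N] are inspected by [cmem], where the
    default [k] does not occur. *)
Let ext N (c : {ffun 'I_N -> 'I_m}) (i : nat) : 'I_m :=
  if insub i.-1 is Some i' then c i' else k.

Let cmem N (c : {ffun 'I_N -> 'I_m}) := members (ext c) N.+1 k.

Lemma cmemE N w : cmem (labels K N w) = mem w N.
Proof.
apply: eq_members => i; rewrite ltnS => iN.
by rewrite /ext/= insubT ffunE.
Qed.

Let many J N : set T := [set w | (J <= size (mem w N))%N].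

Let E (s : seq nat) (A : nat -> set plane) : set T :=
  \bigcap_(j in [set` s]) (thin j @^-1` A j).

(** The event [E s A] on [many J N], for a fixed label word: indexed by points, as [joint_law]
    expects, with [index] recovering the rank of a point within its label. *)
Let Ec (s : seq nat) (A : nat -> set plane) J N (c : {ffun 'I_N -> 'I_m}) : set T :=
  if (J <= size (cmem c))%N then
    \bigcap_(i in [set` [seq nth 0%N (cmem c) j | j <- s]])
      (X i @^-1` A (index i (cmem c)))
  else set0.

Lemma thin_labels s A J N : (forall j, j \in s -> (j < J)%N) ->
  E s A `&` many J N = [set w | Ec s A J (labels K N w) w].
Proof.
move=> sJ; apply/seteqP; split => w /=; rewrite /Ec cmemE.
  move=> [hE hJ]; have hJ' : (J <= size (mem w N))%N := hJ.
  rewrite hJ' => i /mapP[j js ->] /=.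
  have jm := leq_trans (sJ j js) hJ'.
  rewrite index_uniq ?filter_uniq ?iota_uniq//.
  by have := hE j js; rewrite /thin /preimage /= (member_indexE jm).
case: ifPn => // hJ hE; split => // j /= js.
have jm := leq_trans (sJ j js) hJ.
have := hE (nth 0%N (mem w N) j); rewrite /= map_f// => /(_ isT).
rewrite index_uniq ?filter_uniq ?iota_uniq//.
by rewrite /thin /preimage /= (member_indexE jm).
Qed.

Lemma measurable_Ec s A J N (c : {ffun 'I_N -> 'I_m}) :
  (forall j, measurable (A j)) -> measurable (Ec s A J c).
Proof.
move=> mA; rewrite /Ec; case: ifP => // _; apply: fin_bigcap_measurable => // i _.
exact: (measurable_point model).
Qed.

Lemma measurable_many J N : measurable (many J N).
Proof.
have mE (c : {ffun 'I_N -> 'I_m}) : measurable (Ec [::] (fun=> setT) J c).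
  exact: measurable_Ec.
have := measurable_labels_dep model mE.
rewrite -thin_labels// /E (_ : \bigcap_(j in _) _ = setT) ?setTI//.
by apply/seteqP; split.
Qed.

(** For each word with at least [J] occurrences of [k], the selected indices are distinct, so the
    positions contribute the same product whatever the word. The case of an empty [s] identifies the
    remaining sum with [P (many J N)]. *)
Lemma prob_thin_many s A J N : uniq s -> (forall j, measurable (A j)) ->
  (forall j, j \in s -> (j < J)%N) ->
  P (E s A `&` many J N) = (P (many J N) * \prod_(j <- s) P (X 0%N @^-1` A j))%E.
Proof.
move=> us mA sJ.
have key s' A' : uniq s' -> (forall j, measurable (A' j)) ->
    (forall j, j \in s' -> (j < J)%N) -> P (E s' A' `&` many J N) =
    ((\sum_(c : {ffun 'I_N -> 'I_m} | (J <= size (cmem c))%N)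
      \prod_(i < N) (p (c i))%:E) * \prod_(j <- s') P (X 0%N @^-1` A' j))%E.
  move=> us' mA' sJ'; rewrite thin_labels//.
  rewrite (@prob_labels_dep _ _ _ _ _ _ _ _ _ model N (@Ec s' A' J N))//; last first.
    by move=> c; exact: measurable_Ec.
  rewrite ge0_sume_distrl; last first.
    by move=> c _; apply: prode_ge0 => i _; rewrite lee_fin (label_prob_ge0 model).
  rewrite [RHS]big_mkcond; apply: eq_bigr => c _; rewrite /Ec.
  case: ifPn => hJ; last by rewrite setI0 measure0.
  have inj : {in s' &, injective (nth 0%N (cmem c))}.
    move=> i j /sJ' iJ /sJ' jJ /eqP.
    rewrite nth_uniq ?filter_uniq ?iota_uniq//; try exact: leq_trans hJ.
    by move/eqP.
  rewrite (joint_law model)//; last by rewrite map_inj_in_uniq.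
  congr (_ * _)%E; rewrite big_map big_seq [RHS]big_seq; apply: eq_bigr => j js.
  rewrite index_uniq ?filter_uniq ?iota_uniq ?(leq_trans (sJ' j js))//.
  exact: (point_law model).
rewrite key//; congr (_ * _)%E.
have := key [::] (fun=> setT) isT (fun=> measurableT).
rewrite big_nil mule1 => <-//; congr (P _).
by rewrite -[RHS]setTI; congr (_ `&` _); apply/seteqP; split.
Qed.

Lemma many_homo J : {homo many J : N N' / (N <= N')%N >-> (N <= N')%O}.
Proof.
move=> N N' le; apply/subsetPset => w /= h; apply: leq_trans h _.
exact: leq_size_members.
Qed.

(** Since [p k > 0], the frequency eventually exceeds [p k / 2], giving more than [J] points once
    [n > J / (p k / 2)]. *)
Lemma prob_bigcup_many J : P (\bigcup_N many J N) = 1%E.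
Proof.
have mm : measurable (\bigcup_N many J N).
  by apply: bigcup_measurable => N _; exact: measurable_many.
have : P.-negligible (~` \bigcup_N many J N).
  have [N [mN N0 sub]] := label_frequency model k.
  exists N; split => // w hw; apply: sub => /= cv; apply: hw.
  have half_lt : p k / 2 < p k by rewrite ltr_pdivrMr// mulr_natr mulr2n ltrDl.
  have hcv : \forall n \near \oo,
      p k / 2 < (size (members (fun i => K i w) n k))%:R / n%:R.
    exact: (cvgr_gt (p k) cv _ half_lt).
  near \oo => n.
  have n0 : (0 < n)%N by near: n; exact: nbhs_infty_gt.
  exists n => //; rewrite /many /=.
  have h1 : p k / 2 < (size (members (fun i => K i w) n k))%:R / n%:R.
    by near: n.
  have h2 : J%:R / (p k / 2) < n%:R by near: n; exact: nbhs_infty_gtr.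
  apply: (@leq_trans (size (members (fun i => K i w) n k))); last exact: leq_size_members.
  have n0R : 0 < n%:R :> R by rewrite ltr0n.
  rewrite -(ler_nat R); apply: ltW.
  move: h1; rewrite ltr_pdivlMr//; apply: le_lt_trans.
  by move: h2; rewrite ltr_pdivrMr ?divr_gt0// mulrC => /ltW.
move=> /(measure_negligible (measurableC mm)) h.
have : P (~` \bigcup_N many J N) = 0%E by exact: h.
rewrite probability_setC// => /eqP.
rewrite sube_eq ?fin_num_measure ?fin_num_adde_defl ?fin_num_measure//.
by rewrite add0e eq_sym => /eqP.
Unshelve. all: by end_near.
Qed.


Lemma measurable_thin_many s (A : nat -> set plane) J N : (forall j, measurable (A j)) ->
  (forall j, j \in s -> (j < J)%N) -> measurable (E s A `&` many J N).
Proof.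
move=> mA sJ; rewrite thin_labels//; apply: (measurable_labels_dep model) => c.
exact: measurable_Ec.
Qed.

(** Where the [j]-th point exists, the event is a countable union of events determined label word by
    label word; elsewhere [thin j] is [X 0]. *)
Lemma measurable_thin j (A : set plane) :
  measurable A -> measurable (thin j @^-1` A).
Proof.
move=> mA.
have -> : thin j @^-1` A =
    \bigcup_N (E [:: j] (fun=> A) `&` many j.+1 N) `|`
    ((~` \bigcup_N many j.+1 N) `&` X 0%N @^-1` A).
  apply/seteqP; split => w /=.
    move=> hw; have [[N _ hN]|no] := pselect ((\bigcup_N many j.+1 N) w).
      left; exists N => //; split => // i /=.
      by rewrite inE => /eqP ->.
    right; split => //; move: hw; rewrite /thin member_index_default// => n.
    rewrite leqNgt; apply/negP => hn; apply: no.
    exists n => //; rewrite /many /=; apply: leq_trans hn _.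
    exact: leq_size_members.
  case=> [[N _ [hE _]]|[no hX]]; first by apply: hE; rewrite /= mem_head.
  rewrite /thin member_index_default// => n.
  rewrite leqNgt; apply/negP => hn; apply: no.
  exists n => //; rewrite /many /=; apply: leq_trans hn _.
  exact: leq_size_members.
apply: measurableU.
  apply: bigcup_measurable => N _; apply: measurable_thin_many => // i.
  by rewrite inE => /eqP ->.
apply: measurableI; last exact: (measurable_point model).
by apply: measurableC; apply: bigcup_measurable => N _; exact: measurable_many.
Qed.

(** Limit in [N] of [prob_thin_many]: the events [many J N] increase to an event of probability 1,
    so the same sequence tends to both sides. *)
Lemma thin_joint_law s (A : nat -> set plane) : uniq s -> (forall j, measurable (A j)) ->
  P (\bigcap_(j in [set` s]) (thin j @^-1` A j)) =
  (\prod_(j <- s) P (X 0%N @^-1` A j))%E.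
Proof.
move=> us mA; rewrite -/(E s A).
pose J := (\max_(j <- s) j).+1.
have sJ j : j \in s -> (j < J)%N.
  by move=> js; rewrite ltnS (@leq_bigmax_seq _ s predT id).
have mE : measurable (E s A).
  by apply: fin_bigcap_measurable => // j _; exact: measurable_thin.
have mU : measurable (\bigcup_N many J N).
  by apply: bigcup_measurable => N _; exact: measurable_many.
have PU : P (\bigcup_N (E s A `&` many J N)) = P (E s A).
  rewrite -setI_bigcupr; set U := \bigcup_N _.
  have mC : measurable (~` U) by exact: measurableC.
  have mEU : measurable (E s A `&` U) by exact: measurableI.
  have mEC : measurable (E s A `&` ~` U) by exact: measurableI.
  have U0 : P (~` U) = 0%E by rewrite probability_setC// prob_bigcup_many subee.
  have EC0 : P (E s A `&` ~` U) = 0%E.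
    exact: subset_measure0 mEC mC (@subIsetr _ _ _) U0.
  rewrite -[in RHS](setIT (E s A)) -(setUv U) setIUr.
  by rewrite (measureU0 _ _ EC0).
have cv1 : (P (E s A `&` many J N) @[N --> \oo] --> P (E s A))%E.
  rewrite -PU; apply: nondecreasing_cvg_mu.
  - by move=> N; exact: measurable_thin_many.
  - by apply: bigcup_measurable => N _; exact: measurable_thin_many.
  - move=> N N' le; apply/subsetPset => w [hE hm]; split => //.
    by have /subsetPset := many_homo J le; apply.
have cv2 : (P (E s A `&` many J N) @[N --> \oo] -->
    \prod_(j <- s) P (X 0%N @^-1` A j))%E.
  under eq_fun do rewrite prob_thin_many//.
  have Cfin : (\prod_(j <- s) P (X 0%N @^-1` A j))%E \is a fin_num.
    apply: prode_fin_num => j _; apply: fin_num_measure.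
    exact: (measurable_point model).
  have : (P (many J N) @[N --> \oo] --> 1)%E.
    rewrite -(prob_bigcup_many J); apply: nondecreasing_cvg_mu => //.
      by move=> N; exact: measurable_many.
    exact: many_homo.
  by move=> /(cvgeZr Cfin); rewrite mul1e; exact.
exact: (cvg_unique _ cv1 cv2).
Qed.

End Thinning.

(** * Asymptotic lengths *)

Section Asymptotics.
Variables (R : realType) (d : measure_display) (T : measurableType d).
Variables (P : probability T R) (a : R) (m : nat) (p : 'I_m -> R).
Variables (X : nat -> T -> R * R) (K : nat -> T -> 'I_m).
Hypothesis model : mts_model P a p X K.

Notation plane := (measurableTypeR R * measurableTypeR R)%type.

Lemma iid_thin k : 0 < p k -> iid_uniform P a (thin X K k).
Proof.
move=> pk; split.
  move=> i; split.
    by move=> _ [A mA <-]; rewrite setTI; exact: (measurable_thin model).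
  move=> A mA.
  have := @thin_joint_law _ _ _ _ _ _ _ _ _ model _ pk [:: i] (fun=> A) isT (fun=> mA).
  rewrite big_seq1 set_cons1 bigcap_set1 => ->.
  by case: model => /(_ 0%N)[_ ->].
move=> s A us hA.
have {}hA i : exists B : set plane, measurable B /\ thin X K k i @^-1` B = A i.
  by have [B mB] := hA i; rewrite setTI => <-; exists B.
have [B hB] := choice hA.
have mB i : measurable (B i) by case: (hB i).
have -> : \bigcap_(i in [set` s]) A i = \bigcap_(i in [set` s]) (thin X K k i @^-1` B i).
  by apply: eq_bigcapr => i _; rewrite (hB i).2.
rewrite (thin_joint_law model pk us mB); apply: eq_bigr => i _.
have := @thin_joint_law _ _ _ _ _ _ _ _ _ model _ pk [:: i] B isT mB.
by rewrite big_seq1 set_cons1 bigcap_set1 => <-; rewrite (hB i).2.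
Qed.

Lemma iid_points : iid_uniform P a X.
Proof.
case: model => hu _ _ ind; split => // s A us hA.
have := ind (map inl s) (fun j => if j is inl i then A i else setT).
rewrite big_map map_inj_uniq; last by move=> ? ? [].
move=> <-//.
- congr (P _); apply/seteqP; split => w hw.
    by move=> _ /mapP[i si ->]; exact: hw.
  by move=> i si; have := hw (inl i); apply; exact: map_f.
- case=> i //; exists setT => //.
  by rewrite setTI preimage_setT.
Qed.

(** Supplies, outside a null set, the uniform distance bound [D] of the deterministic part. *)
Lemma ae_square : {ae P, forall w, forall i, square a (X i w)}.
Proof.
apply: ae_foralln => i.
have msq : measurable (square a : set plane).
  by apply: measurableX; exact: measurable_itv.
exists (X i @^-1` (~` square a)); split => //.
  by apply: (measurable_point model); exact: measurableC.
suff : P (X i @^-1` (~` square a)) = 0%E by exact.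
case: model => /(_ i)[_ ->]; last exact: measurableC.
by rewrite setICl measure0 mule0.
Qed.

Lemma dist_square (x y : R * R) : square a x -> square a y -> dist x y <= a *+ 2.
Proof.
rewrite /square /= !in_itv /= => -[/andP[x1 x2] /andP[x3 x4]] [/andP[y1 y2] /andP[y3 y4]].
have a0 : 0 <= a by exact: le_trans x2.
rewrite -ler_sqr ?nnegrE ?dist_ge0 ?mulrn_wge0//.
rewrite /dist sqr_sqrtr ?addr_ge0 ?sqr_ge0//.
have sq_le (u v : R) : 0 <= u -> u <= a -> 0 <= v -> v <= a ->
    (u - v) ^+ 2 <= a ^+ 2.
  move=> u0 ua v0 va.
  have : 0 <= (a - (u - v)) * (a + (u - v)) by apply: mulr_ge0; lra.
  rewrite -subr_sqr; lra.
have := sq_le _ _ x1 x2 y1 y2; have := sq_le _ _ x3 x4 y3 y4.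
rewrite -mulr_natl exprMn; have := sqr_ge0 a; lra.
Qed.

(** With [N n] points of label [k], the ratio is [tsp / sqrt (N n)] times [sqrt (N n / n)]; as [N n]
    tends to infinity, the first factor is a limit along a random subsequence. *)
Lemma tsp_members_cvg (beta : R) k : is_BHH_constant beta -> 0 < a -> 0 < p k ->
  {ae P, forall w,
    tsp_shortest (thin X K k ^~ w) (size (members (K ^~ w) n k)) / Num.sqrt n%:R
      @[n --> \oo] --> beta * Num.sqrt (a ^+ 2) * Num.sqrt (p k)}.
Proof.
move=> hbeta a0 pk.
have bhh := hbeta _ _ _ _ _ a0 (iid_thin pk).
have freq := label_frequency model k.
apply: filterS2 bhh freq => w bhh freq.
set N := fun n => size (members (K ^~ w) n k).
have half_lt : p k / 2 < p k by rewrite ltr_pdivrMr// mulr_natr mulr2n ltrDl.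
have large : \forall n \near \oo, p k / 2 < (N n)%:R / n%:R.
  exact: (cvgr_gt (p k) freq _ half_lt).
have N_oo : N n @[n --> \oo] --> \oo.
  apply/cvgnyPge => J; near=> n.
  have n0 : 0 < n%:R :> R by rewrite ltr0n; near: n; exact: nbhs_infty_gt.
  have h1 : p k / 2 < (N n)%:R / n%:R by near: n.
  have h2 : J%:R / (p k / 2) < n%:R by near: n; exact: nbhs_infty_gtr.
  rewrite -(ler_nat R); apply: ltW.
  move: h1; rewrite ltr_pdivlMr//; apply: le_lt_trans.
  by move: h2; rewrite ltr_pdivrMr ?divr_gt0// mulrC => /ltW.
have c1 := cvg_comp _ _ N_oo bhh.
have c2 : Num.sqrt ((N n)%:R / n%:R) @[n --> \oo] --> Num.sqrt (p k).
  apply: (cvg_comp _ _ freq); exact: sqrt_continuous.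
have c3 : tsp_shortest (thin X K k ^~ w) (N n) / Num.sqrt (N n)%:R *
    Num.sqrt ((N n)%:R / n%:R) @[n --> \oo] -->
    beta * Num.sqrt (a ^+ 2) * Num.sqrt (p k) by exact: (cvgM c1 c2).
apply: (cvg_trans _ c3); apply: near_eq_cvg; near=> n.
have n0 : 0 < n%:R :> R by rewrite ltr0n; near: n; exact: nbhs_infty_gt.
have h1 : p k / 2 < (N n)%:R / n%:R by near: n.
have N0 : 0 < (N n)%:R :> R.
  by move: h1; rewrite ltr_pdivlMr//; apply: le_lt_trans; rewrite !mulr_ge0// ltW.
rewrite sqrtrM ?ler0n// sqrtrV ?ler0n//.
by field; rewrite !sqrtr_eq0 -!ltNge N0 n0.
Unshelve. all: by end_near.
Qed.

End Asymptotics.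

Lemma cvg_sum (R : realType) (I : Type) (r : seq I) (f : I -> nat -> R) (l : I -> R) :
  (forall i, f i n @[n --> \oo] --> l i) ->
  \sum_(i <- r) f i n @[n --> \oo] --> \sum_(i <- r) l i.
Proof.
move=> fl; elim: r => [|i r ih].
  by under eq_fun do rewrite big_nil; rewrite big_nil; exact: cvg_cst.
under eq_fun do rewrite big_cons; rewrite big_cons; exact: cvgD.
Qed.

(** The horizon and the slots may vary with [n], because the error of [mts_shortest_approx] depends
    on [a] and [m] only. The general and the identical slots are both instances. *)
Lemma mts_shortest_asymptotics (R : realType) (d : measure_display)
    (T : measurableType d) (P : probability T R) (a beta : R) (m : nat)
    (p : 'I_m -> R) (X : nat -> T -> R * R) (K : nat -> T -> 'I_m)
    (h : nat -> R) (B F : nat -> 'I_m -> R) (L : nat -> R) :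
  mts_model P a p X K -> is_BHH_constant beta -> 0 < a ->
  (forall k, 0 < p k) -> (forall n, is_slot_partition (h n) (B n) (F n)) ->
  {ae P, forall w, \forall n \near \oo, considered p n ->
     mts_has_feasible (h n) (B n) (F n) (X ^~ w) (K ^~ w) n} ->
  (forall n, L n = beta * a * (\sum_k Num.sqrt (p k)) * Num.sqrt n%:R) ->
  is_asymptotic_length P (considered p)
    (fun n w => mts_shortest (h n) (B n) (F n) (X ^~ w) (K ^~ w) n) L.
Proof.
move=> model hbeta a0 p0 hslots hfeas LE.
split; first by exists (beta * a * \sum_k Num.sqrt (p k)).
have tsp : {ae P, forall w, forall k : 'I_m,
    tsp_shortest (thin X K k ^~ w) (size (members (K ^~ w) n k)) / Num.sqrt n%:R
      @[n --> \oo] --> beta * Num.sqrt (a ^+ 2) * Num.sqrt (p k)}.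
  by apply: filter_forall => k; exact: tsp_members_cvg.
apply: filterS3 hfeas tsp (ae_square model) => w feas tsp sq.
pose S n := \sum_k tsp_shortest (thin X K k ^~ w) (size (members (K ^~ w) n k)).
have cS : S n / Num.sqrt n%:R @[n --> \oo] --> beta * a * \sum_k Num.sqrt (p k).
  have -> : beta * a * \sum_k Num.sqrt (p k) =
      \sum_k beta * Num.sqrt (a ^+ 2) * Num.sqrt (p k).
    by rewrite big_distrr /= sqrtr_sqr gtr0_norm.
  rewrite /S; under eq_fun do rewrite big_distrl /=.
  by apply: cvg_sum => k; exact: tsp.
(* The error of [mts_shortest_approx] at [D = a *+ 2]. *)
set C := (a *+ 2 *+ 2 + 1) *+ m + a *+ 2.
apply/cvgrPdist_lt => e e0; rewrite near_withinE.
have e2 : 0 < e / 2 by rewrite divr_gt0.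
move/cvgrPdist_lt : cS => /(_ _ e2) cS.
have C0 : 0 <= C by rewrite addr_ge0 ?mulrn_wge0 ?addr_ge0 ?mulrn_wge0 ?ltW.
near=> n => nconsidered.
have n0 : 0 < Num.sqrt n%:R :> R.
  by rewrite sqrtr_gt0 ltr0n; near: n; exact: nbhs_infty_gt.
have fn : considered p n ->
    mts_has_feasible (h n) (B n) (F n) (X ^~ w) (K ^~ w) n by near: n.
have := mts_shortest_approx (Y := fun k => thin X K k ^~ w) (hslots n) _ _
  (fn nconsidered).
move=> /(_ (a *+ 2)).
have hD i j : dist (X i w) (X j w) <= a *+ 2 by exact: dist_square.
have hY k j : (j < size (members (K ^~ w) n k))%N ->
    thin X K k j w = X (nth 0%N (members (K ^~ w) n k) j) w.
  by move=> jn; rewrite /thin (member_indexE jn).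
move=> /(_ hD hY).
rewrite -/C -/(S n); set M := mts_shortest _ _ _ _ _ _.
rewrite LE; set c := beta * a * _.
move=> le.
have h1 : `|c - S n / Num.sqrt n%:R| < e / 2 by near: n.
have h2 : C / Num.sqrt n%:R < e / 2.
  have q0 : 0 <= C / (e / 2) by rewrite divr_ge0// ltW.
  have : (C / (e / 2)) ^+ 2 < n%:R by near: n; exact: nbhs_infty_gtr.
  rewrite -[ltRHS](sqr_sqrtr (ler0n R n)) => hC.
  rewrite ltr_pdivrMr// -ltr_pdivrMl// mulrC; move: hC.
  by rewrite ltr_sqr ?nnegrE ?sqrtr_ge0 ?q0.
have -> : 0 - (M - c * Num.sqrt n%:R) / Num.sqrt n%:R =
    (c - S n / Num.sqrt n%:R) - (M - S n) / Num.sqrt n%:R.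
  by field; rewrite gt_eqF.
apply: (le_lt_trans (ler_normB _ _)); rewrite [e in ltRHS]splitr ltrD//.
apply: le_lt_trans h2; rewrite normrM [`|_^-1|]gtr0_norm ?invr_gt0//.
by rewrite ler_pM2r ?invr_gt0.
Unshelve. all: by end_near.
Qed.

(** * Comparison of the leading terms *)

Section SlotLengths.
Variables (R : realType) (m : nat) (h : R) (B F : 'I_m -> R).
Hypothesis hslots : is_slot_partition h B F.

Lemma slot_partition_horizon : (0 < m)%N -> 0 < h.
Proof.
case: hslots => h0 hm _ lt; case: m B F hslots h0 hm lt => // n B' F' hs h0 hm lt _.
rewrite -(hm ord_max)//; apply: le_lt_trans (lt ord_max).
have [e|] := posnP n; first by rewrite h0.
move=> n0; have : F' ord0 <= B' ord_max by apply: (slot_le hs).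
by apply: le_trans; rewrite -(h0 ord0)// ltW.
Qed.

End SlotLengths.

Lemma ident_slot_partition (R : realType) (m : nat) (h : R) : (0 < m)%N -> 0 < h ->
  is_slot_partition h (@ident_B R m h) (@ident_F R m h).
Proof.
move=> m0 h0; have m0R : 0 < m%:R :> R by rewrite ltr0n.
split; rewrite /ident_B /ident_F.
- by move=> k ->; rewrite mul0r.
- by move=> k ->; rewrite mulrC divfK// gt_eqF.
- by move=> k k' ->.
- by move=> k; rewrite ltr_pM2r ?divr_gt0// ltr_nat.
Qed.

(** The sign comes from a limit of nonnegative ratios at one sample point, which exists because a
    null set cannot be all of [T]. *)
Lemma BHH_constant_ge0 (R : realType) (beta a : R) (d : measure_display)
    (T : measurableType d) (P : probability T R) (X : nat -> T -> R * R) :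
  is_BHH_constant beta -> 0 < a -> iid_uniform P a X -> 0 <= beta.
Proof.
move=> hbeta a0 iid; have bhh := hbeta _ _ _ _ _ a0 iid.
have [w cv] : exists w, tsp_shortest (fun i => X i w) n / Num.sqrt n%:R
    @[n --> \oo] --> beta * Num.sqrt (a ^+ 2).
  apply: contrapT => no.
  have : P.-negligible [set: T].
    case: bhh => N [mN N0 sub]; exists N; split => // w _.
    by apply: sub => cv; apply: no; exists w.
  move=> /(measure_negligible measurableT) h0.
  have : P setT = 0%E by exact: h0.
  by rewrite probability_setT => /eqP; rewrite eqe oner_eq0.
have : 0 <= beta * Num.sqrt (a ^+ 2).
  rewrite -(cvg_lim _ cv)//; apply: limr_ge; first by apply/cvg_ex; eexists; exact: cv.
  by apply: nearW => n; rewrite divr_ge0 ?sqrtr_ge0 ?tsp_shortest_ge0.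
by rewrite sqrtr_sqr gtr0_norm// pmulr_lge0.
Qed.

(** Below, [p k <= Num.sqrt (p k)] since [p k <= 1]. Above, with [r = Num.sqrt m], the summed AM-GM
    bounds give [(r + m / r) / 2 = r]. *)
Lemma sum_sqrt_bounds (R : realType) (m : nat) (p : 'I_m -> R) :
  (forall k, 0 <= p k) -> \sum_k p k = 1 ->
  1 <= \sum_k Num.sqrt (p k) <= Num.sqrt m%:R.
Proof.
move=> p0 p1; apply/andP; split.
  rewrite -p1; apply: ler_sum => k _.
  have pk1 : Num.sqrt (p k) <= 1.
    by rewrite -sqrtr1 ler_wsqrtr// -p1 (bigD1 k)//= lerDl sumr_ge0.
  by rewrite -{1}(sqr_sqrtr (p0 k)) expr2 ler_piMr ?sqrtr_ge0.
have m0 : (0 < m)%N.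
  rewrite lt0n; apply/eqP => m0; move: p p0 p1; rewrite m0 => p _.
  by rewrite big_ord0 => /esym/eqP; rewrite oner_eq0.
set r := Num.sqrt m%:R.
have r0 : 0 < r by rewrite sqrtr_gt0 ltr0n.
have rr : r * r = m%:R by rewrite -expr2 sqr_sqrtr.
(* AM-GM, with equality at [p k = 1 / m] *)
have amgm k : Num.sqrt (p k) <= (r * p k + r^-1) / 2.
  have := sqr_ge0 (r * Num.sqrt (p k) - 1).
  rewrite sqrrB exprMn (sqr_sqrtr (p0 k)) mulr1 expr1n => h.
  rewrite ler_pdivlMr// -(ler_pM2l r0) (mulrDr r (r * p k)) mulfV ?gt_eqF//; lra.
apply: le_trans (ler_sum _ (fun k _ => amgm k)) _.
rewrite -big_distrl big_split /= -big_distrr /= p1 mulr1 sumr_const card_ord.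
rewrite -[_ *+ m]mulr_natr -rr mulKf ?gt_eqF//; lra.
Qed.

Theorem proposition3 (R : realType) (beta : R) (d : measure_display)
    (T : measurableType d) (P : probability T R) (a : R) (m : nat)
    (h : nat -> R) (B F : nat -> 'I_m -> R) (p : 'I_m -> R)
    (X : nat -> T -> R * R) (K K' : nat -> T -> 'I_m)
    (hbeta : is_BHH_constant beta)
    (ha : 0 < a)
    (hm : (1 <= m)%N)
    (hslots : forall n, is_slot_partition (h n) (B n) (F n))
    (hp : forall n k, p k = (F n k - B n k) / h n)
    (hmts : mts_model P a p X K)
    (hmits : mts_model P a (fun _ : 'I_m => m%:R^-1) X K')
    (hfeas : {ae P, forall w, \forall n \near \oo, considered p n ->
       mts_has_feasible (h n) (B n) (F n)
         (fun i => X i w) (fun i => K i w) n})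
    (hfeas' : {ae P, forall w, \forall n \near \oo,
       considered (fun _ : 'I_m => m%:R^-1 : R) n ->
       mts_has_feasible (h n) (ident_B (h n)) (ident_F (h n))
         (fun i => X i w) (fun i => K' i w) n}) :
  [/\ is_asymptotic_length P [set n | (0 < n)%N]
        (fun n w => tsp_shortest (fun i => X i w) n)
        (L_tsp beta a),
      is_asymptotic_length P (considered p)
        (fun n w => mts_shortest (h n) (B n) (F n)
                      (fun i => X i w) (fun i => K i w) n)
        (fun n => L_mts beta a (h n) (fun k => F n k - B n k) n),
      is_asymptotic_length P (considered (fun _ : 'I_m => m%:R^-1 : R))
        (fun n w => mts_shortest (h n) (ident_B (h n)) (ident_F (h n))
                      (fun i => X i w) (fun i => K' i w) n)
        (L_mits beta a m) &
      forall n : nat,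
        L_tsp beta a n
          <= L_mts beta a (h n) (fun k => F n k - B n k) n
          <= L_mits beta a m n].
Proof.
have m0R : 0 < m%:R :> R by rewrite ltr0n.
have h0 n : 0 < h n := slot_partition_horizon (hslots n) hm.
have p0 k : 0 < p k.
  rewrite (hp 0%N k) divr_gt0// subr_gt0.
  by case: (hslots 0%N) => _ _ _; exact.
have beta0 : 0 <= beta := BHH_constant_ge0 hbeta ha (iid_points hmts).
have sqrt_a : Num.sqrt (a ^+ 2) = a by rewrite sqrtr_sqr gtr0_norm.
have LtspE n : L_tsp beta a n = beta * a * Num.sqrt n%:R.
  by rewrite /L_tsp (sqrtrM _ (ler0n _ n)) sqrt_a; ring.
have LmtsE n : L_mts beta a (h n) (fun k => F n k - B n k) n =
    beta * a * (\sum_k Num.sqrt (p k)) * Num.sqrt n%:R.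
  have na0 : 0 <= n%:R * a ^+ 2 by rewrite mulr_ge0 ?ler0n ?sqr_ge0.
  rewrite /L_mts (sqrtrM _ na0) (sqrtrM _ (ler0n _ n)) sqrt_a.
  have -> : \sum_k Num.sqrt (p k) =
      Num.sqrt (h n)^-1 * \sum_k Num.sqrt (F n k - B n k).
    rewrite big_distrr; apply: eq_bigr => k _ /=.
    by rewrite (hp n k) mulrC sqrtrM// invr_ge0 ltW.
  by ring.
have LmitsE n : L_mits beta a m n = beta * a * Num.sqrt m%:R * Num.sqrt n%:R.
  rewrite /L_mits -natrM (sqrtrM _ (ler0n _ _)) natrM (sqrtrM _ (ler0n _ n)).
  by rewrite sqrt_a; ring.
split.
- split; first by exists (beta * a) => n; exact: LtspE.
  have bhh := hbeta _ _ _ _ _ ha (iid_points hmts).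
  apply: filterS bhh => w bhh; apply/cvgrPdist_lt => e e0; rewrite near_withinE.
  move/cvgrPdist_lt : bhh => /(_ _ e0); apply: filterS => n le /= n0.
  apply: le_lt_trans le; rewrite LtspE sqrt_a sub0r normrN mulrBl mulfK; last first.
    by rewrite gt_eqF// sqrtr_gt0 ltr0n.
  by rewrite distrC.
- exact: (mts_shortest_asymptotics hmts hbeta ha p0 hslots hfeas LmtsE).
- apply: (mts_shortest_asymptotics hmits hbeta ha _ _ hfeas') => [k|n|n].
  + by rewrite invr_gt0.
  + exact: ident_slot_partition.
  + rewrite LmitsE sumr_const card_ord sqrtrV// -[_^-1 *+ m]mulr_natl.
    suff -> : m%:R / Num.sqrt m%:R = Num.sqrt m%:R :> R by [].
    by rewrite -[X in X / _](sqr_sqrtr (ler0n R m)) expr2 mulfK// gt_eqF// sqrtr_gt0.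
move=> n; rewrite LtspE LmtsE LmitsE.
have /andP[s1 s2] := sum_sqrt_bounds (fun k => ltW (p0 k)) (sum_label_prob hmts).
have c0 : 0 <= beta * a by rewrite mulr_ge0// ltW.
rewrite !ler_wpM2r ?sqrtr_ge0 ?ler_wpM2l//.
by rewrite -[leLHS]mulr1 ler_wpM2l.
Qed.
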